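(* Let $M$ be a $6$-dimensional nilmanifold, with non-abelian underlying Lie algebra, endowed with an invariant balanced Hermitian structure $(J,F)$. If $J$ is abelian, then there is an invariant non-flat $\mathrm{SU}(3)$-instanton solving the Strominger system (with constant dilaton) with respect to the Bismut connection in the anomaly cancellation condition. Moreover, any such solution solves in addition the heterotic equations of motion if and only if $M$ is a compact quotient of $H\times\mathbb R$, $H$ being the generalized $5$-dimensional Heisenberg group.
   Context: A nilmanifold is a compact quotient $M=\Gamma\backslash G$ of a simply-connected nilpotent Lie group by a lattice of maximal rank; its underlying Lie algebra is the Lie algebra $\mathfrak g$ of $G$. Invariant objects on $M$ are those induced by left-invariant objects on $G$; an invariant connection is one whose connection forms in a left-invariant coframe are left-invariant $1$-forms. A complex structure $J$ on $\mathfrak g$ is abelian if $[JX,JY]=[X,Y]$ for all $X,Y$. The Lie algebra of $H\times\mathbb R$ is $\mathfrak h_3$, whose dual has a basis with $de^1=\cdots=de^5=0$, $de^6=e^1\wedge e^2+e^3\wedge e^4$. $J$ acts on $1$-forms by $(J\alpha)(X)=-\alpha(JX)$. A Hermitian structure $(J,F)$ with metric $g$ has $F(X,Y)=g(X,JY)$, and is balanced (in dimension 6) if $d(F\wedge F)=0$. The Bismut connection is $\nabla=\nabla^g+\frac12T$, with $\nabla^g$ the Levi-Civita connection and $T=JdF$, i.e. $T(X,Y,Z)=-dF(JX,JY,JZ)$. For an invariant balanced Hermitian structure, fix an invariant orthonormal coframe $\{e^1,\ldots,e^6\}$ with $Je^1=-e^2$, $Je^3=-e^4$, $Je^5=-e^6$,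 $F=e^{12}+e^{34}+e^{56}$ ($e^{ij}=e^i\wedge e^j$), with dual frame $\{e_1,\ldots,e_6\}$, and the $\mathrm{SU}(3)$-structure $(J,F,\Psi)$ with $\Psi=(e^1+ie^2)\wedge(e^3+ie^4)\wedge(e^5+ie^6)$. For a connection with connection forms $\sigma^i_j$, the curvature forms are $\Omega^i_j=d\sigma^i_j+\sum_k\sigma^i_k\wedge\sigma^k_j$. An $\mathrm{SU}(3)$-instanton is an $\mathrm{SU}(3)$-connection $A$ (preserving $F$ and $\Psi$) whose curvature $2$-forms lie in $\mathfrak{su}(3)$, i.e. for all $i,j,k,l$: $(\Omega^A)^i_j(e_1,e_2)+(\Omega^A)^i_j(e_3,e_4)+(\Omega^A)^i_j(e_5,e_6)=0$ and $(\Omega^A)^i_j(Je_k,Je_l)=(\Omega^A)^i_j(e_k,e_l)$. A solution of the Strominger system with constant dilaton is a compact $6$-manifold with a Hermitian $\mathrm{SU}(3)$-structure $(J,F,\Psi)$ such that: (a) the holonomy of the Bismut connection $\nabla$ is contained in $\mathrm{SU}(3)$; (b) $(J,F)$ is balanced; (c) there is an $\mathrm{SU}(3)$-instanton $A$, required to be non-flat; (d) (anomaly cancellation) $dT=2\pi^2\alpha'\big(p_1(\nabla)-p_1(A)\big)$ for some constant $\alpha'>0$, where $p_1=\frac{1}{8\pi^2}\sum_{1\le i<j\le 6}\Omega^i_j\wedge\Omega^i_j$. A solution of the Strominger system is said to solve the heterotic equations of motion if and only if the connection $\nabla$ used in (d) is an $\mathrm{SU}(3)$-instanton; this is Ivanov's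 characterization and is how the term is used here. *)

(* Defs.v *)
From HB Require Import structures.
From mathcomp Require Import all_boot all_order all_algebra.
From mathcomp Require Import ring.
From mathcomp Require Import complex.
From mathcomp Require Import all_classical reals topology normedtype derive.
From mathcomp Require Import trigo.

Set Implicit Arguments.
Unset Strict Implicit.
Unset Printing Implicit Defensive.

Import Order.TTheory GRing.Theory Num.Theory.
Import numFieldNormedType.Exports.

Local Open Scope classical_set_scope.
Local Open Scope ring_scope.

(* Frames and matrices are indexed by 'I_6, which counts from 0; [ix k] is the
   index written k in the usual numbering 1, ..., 6. *)
Definition ix (k : nat) : 'I_6 := inord k.-1.

(* A linear isomorphism with R^6 is fixed once and for all; the bracket is
   arbitrary.  The last field says that the lower central series vanishes after
   finitely many steps. *)
Record nilpotent_lie_algebra (R : realType) := NilpotentLieAlgebra {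
  br : 'rV[R]_6 -> 'rV[R]_6 -> 'rV[R]_6;
  br_linearl : forall Y, linear (br^~ Y);
  br_linearr : forall X, linear (br X);
  br_alternating : forall X, br X X = 0;
  br_jacobi : forall X Y Z,
    br X (br Y Z) + br Y (br Z X) + br Z (br X Y) = 0;
  br_nilpotent : exists n : nat, forall (Y : 'rV[R]_6) (s : seq 'rV[R]_6),
    size s = n -> foldr br Y s = 0
}.

Definition abelian_lie_algebra (R : realType) (L : nilpotent_lie_algebra R) :=
  forall X Y, br L X Y = 0.

(* The simply-connected group G with Lie algebra L, in exponential coordinates:
   its underlying manifold is L itself, exp being a diffeomorphism, and its
   product is the Baker-Campbell-Hausdorff series.  A nilpotent Lie algebra of
   dimension 6 has step at most 5, so the terms of degree at least 6 vanish. *)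
Definition gmul (R : realType) (L : nilpotent_lie_algebra R)
    (X Y : 'rV[R]_6) : 'rV[R]_6 :=
  let b := br L in
  X + Y + 2^-1 *: b X Y
  + 12^-1 *: (b X (b X Y) + b Y (b Y X))
  - 24^-1 *: b Y (b X (b X Y))
  - 720^-1 *: (b Y (b Y (b Y (b Y X))) + b X (b X (b X (b X Y))))
  + 360^-1 *: (b X (b Y (b Y (b Y X))) + b Y (b X (b X (b X Y))))
  + 120^-1 *: (b Y (b X (b Y (b X Y))) + b X (b Y (b X (b Y X)))).

Definition ginv (R : realType) (X : 'rV[R]_6) : 'rV[R]_6 := - X.

Definition is_lattice (R : realType) (L : nilpotent_lie_algebra R)
    (G : set 'rV[R]_6) :=
  [/\ G 0,
      forall x y, G x -> G y -> G (gmul L x y),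
      forall x, G x -> G (ginv x),
      exists2 U : set 'rV[R]_6, nbhs (0 : 'rV[R]_6) U & U `&` G = [set 0] &
      exists2 K : set 'rV[R]_6, compact K &
        forall x, exists h k, [/\ G h, K k & x = gmul L h k]].

(* M = Gamma\G.  Left-invariant tensors on G descend to M, and are given by
   their values on L. *)
Record nilmanifold (R : realType) := Nilmanifold {
  lie :> nilpotent_lie_algebra R;
  lattice : set 'rV[R]_6;
  latticeP : is_lattice lie lattice
}.

(* (a /\ b)(X, Y) = a(X) b(Y) - a(Y) b(X): the wedge product is the sum over
   shuffles, without normalizing factor. *)
Definition wedge11 (V : Type) (K : pzRingType) (a b : V -> K) : V -> V -> K :=
  fun X Y => a X * b Y - a Y * b X.

Definition wedge21 (V : Type) (K : pzRingType) (a : V -> V -> K) (b : V -> K) :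
    V -> V -> V -> K :=
  fun X Y Z => a X Y * b Z - a X Z * b Y + a Y Z * b X.

Definition wedge22 (V : Type) (K : pzRingType) (a b : V -> V -> K) :
    V -> V -> V -> V -> K :=
  fun X Y Z W =>
    a X Y * b Z W - a X Z * b Y W + a X W * b Y Z
    + a Y Z * b X W - a Y W * b X Z + a Z W * b X Y.

(* The differential of invariant k-forms, k = 1, 2, 3, 4:
   da(X_0, ..., X_k)
     = \sum_(i < j) (-1)^(i+j) a([X_i, X_j], X_0, ..^i..^j.., X_k). *)
Definition d1 (R : realType) (L : nilpotent_lie_algebra R)
    (a : 'rV[R]_6 -> R) : 'rV[R]_6 -> 'rV[R]_6 -> R :=
  fun X Y => - a (br L X Y).

Definition d2 (R : realType) (L : nilpotent_lie_algebra R)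
    (a : 'rV[R]_6 -> 'rV[R]_6 -> R) : 'rV[R]_6 -> 'rV[R]_6 -> 'rV[R]_6 -> R :=
  let b := br L in
  fun X Y Z => - a (b X Y) Z + a (b X Z) Y - a (b Y Z) X.

Definition d3 (R : realType) (L : nilpotent_lie_algebra R)
    (a : 'rV[R]_6 -> 'rV[R]_6 -> 'rV[R]_6 -> R) :
    'rV[R]_6 -> 'rV[R]_6 -> 'rV[R]_6 -> 'rV[R]_6 -> R :=
  let b := br L in
  fun X Y Z W =>
    - a (b X Y) Z W + a (b X Z) Y W - a (b X W) Y Z
    - a (b Y Z) X W + a (b Y W) X Z - a (b Z W) X Y.

Definition d4 (R : realType) (L : nilpotent_lie_algebra R)
    (a : 'rV[R]_6 -> 'rV[R]_6 -> 'rV[R]_6 -> 'rV[R]_6 -> R) :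
    'rV[R]_6 -> 'rV[R]_6 -> 'rV[R]_6 -> 'rV[R]_6 -> 'rV[R]_6 -> R :=
  let b := br L in
  fun X Y Z W U =>
    - a (b X Y) Z W U + a (b X Z) Y W U - a (b X W) Y Z U + a (b X U) Y Z W
    - a (b Y Z) X W U + a (b Y W) X Z U - a (b Y U) X Z W
    - a (b Z W) X Y U + a (b Z U) X Y W
    - a (b W U) X Y Z.

Definition complex_structure (R : realType) (L : nilpotent_lie_algebra R)
    (J : {linear 'rV[R]_6 -> 'rV[R]_6}) :=
  (forall X, J (J X) = - X) /\
  (forall X Y, br L (J X) (J Y) - J (br L (J X) Y) - J (br L X (J Y))
               - br L X Y = 0).

Definition abelian_complex_structure (R : realType)
    (L : nilpotent_lie_algebra R) (J : {linear 'rV[R]_6 -> 'rV[R]_6}) :=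
  forall X Y, br L (J X) (J Y) = br L X Y.

Definition inner_product (R : realType) (g : 'rV[R]_6 -> 'rV[R]_6 -> R) :=
  [/\ forall X (a : R) Y Z, g X (a *: Y + Z) = a * g X Y + g X Z,
      forall X Y, g X Y = g Y X &
      forall X, X != 0 -> 0 < g X X].

Definition fundF (R : realType) (J : {linear 'rV[R]_6 -> 'rV[R]_6})
    (g : 'rV[R]_6 -> 'rV[R]_6 -> R) : 'rV[R]_6 -> 'rV[R]_6 -> R :=
  fun X Y => g X (J Y).

Definition hermitian_structure (R : realType) (L : nilpotent_lie_algebra R)
    (J : {linear 'rV[R]_6 -> 'rV[R]_6}) (g : 'rV[R]_6 -> 'rV[R]_6 -> R) :=
  [/\ complex_structure L J, inner_product g &
      forall X Y, g (J X) (J Y) = g X Y].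

Definition balanced (R : realType) (L : nilpotent_lie_algebra R)
    (J : {linear 'rV[R]_6 -> 'rV[R]_6}) (g : 'rV[R]_6 -> 'rV[R]_6 -> R) :=
  forall X Y Z W U, d4 L (wedge22 (fundF J g) (fundF J g)) X Y Z W U = 0.

Definition Jform (R : realType) (J : {linear 'rV[R]_6 -> 'rV[R]_6})
    (a : 'rV[R]_6 -> R) : 'rV[R]_6 -> R :=
  fun X => - a (J X).

(* The coframe dual to a g-orthonormal frame e. *)
Definition coframe (R : realType) (g : 'rV[R]_6 -> 'rV[R]_6 -> R)
    (e : 'I_6 -> 'rV[R]_6) (i : 'I_6) : 'rV[R]_6 -> R :=
  fun X => g (e i) X.

Definition adapted_frame (R : realType) (J : {linear 'rV[R]_6 -> 'rV[R]_6})
    (g : 'rV[R]_6 -> 'rV[R]_6 -> R) (e : 'I_6 -> 'rV[R]_6) :=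
  let c k := coframe g e (ix k) in
  [/\ forall i j, g (e i) (e j) = (i == j)%:R,
      [/\ forall X, Jform J (c 1%N) X = - c 2%N X,
          forall X, Jform J (c 3%N) X = - c 4%N X &
          forall X, Jform J (c 5%N) X = - c 6%N X] &
      forall X Y, fundF J g X Y = wedge11 (c 1%N) (c 2%N) X Y
        + wedge11 (c 3%N) (c 4%N) X Y + wedge11 (c 5%N) (c 6%N) X Y].

Definition Psi (R : realType) (g : 'rV[R]_6 -> 'rV[R]_6 -> R)
    (e : 'I_6 -> 'rV[R]_6) :
    'rV[R]_6 -> 'rV[R]_6 -> 'rV[R]_6 -> complex R :=
  let c k := coframe g e (ix k) in
  let t1 X := Complex (c 1%N X) (c 2%N X) in
  let t2 X := Complex (c 3%N X) (c 4%N X) in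
  let t3 X := Complex (c 5%N X) (c 6%N X) in
  wedge21 (wedge11 t1 t2) t3.

(* An invariant connection is given, in the frame e, by its connection forms:
   [s X i j] is s^i_j(X), that is, nabla_X e_j = \sum_i s^i_j(X) e_i. *)

(* The endomorphism of L with matrix B in the orthonormal frame e. *)
Definition endo (R : realType) (g : 'rV[R]_6 -> 'rV[R]_6 -> R)
    (e : 'I_6 -> 'rV[R]_6) (B : 'M[R]_6) (Y : 'rV[R]_6) : 'rV[R]_6 :=
  \sum_(i < 6) \sum_(j < 6) (B i j * coframe g e j Y) *: e i.

Definition nabla (R : realType) (g : 'rV[R]_6 -> 'rV[R]_6 -> R)
    (e : 'I_6 -> 'rV[R]_6) (s : 'rV[R]_6 -> 'M[R]_6) (X Y : 'rV[R]_6) :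
    'rV[R]_6 :=
  endo g e (s X) Y.

(* nabla F = 0 and nabla Psi = 0; F(Y, Z) and Psi(Y, Z, W) are constant on
   invariant vector fields. *)
Definition su3_connection (R : realType) (J : {linear 'rV[R]_6 -> 'rV[R]_6})
    (g : 'rV[R]_6 -> 'rV[R]_6 -> R) (e : 'I_6 -> 'rV[R]_6)
    (s : 'rV[R]_6 -> 'M[R]_6) :=
  let D := nabla g e s in let F := fundF J g in let P := Psi g e in
  (forall X Y Z, F (D X Y) Z + F Y (D X Z) = 0) /\
  (forall X Y Z W, P (D X Y) Z W + P Y (D X Z) W + P Y Z (D X W) = 0).

Definition curvature (R : realType) (L : nilpotent_lie_algebra R)
    (s : 'rV[R]_6 -> 'M[R]_6) (i j : 'I_6) : 'rV[R]_6 -> 'rV[R]_6 -> R :=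
  let f i j := fun X => s X i j in
  fun X Y => d1 L (f i j) X Y + \sum_(k < 6) wedge11 (f i k) (f k j) X Y.

Definition flat (R : realType) (L : nilpotent_lie_algebra R)
    (s : 'rV[R]_6 -> 'M[R]_6) :=
  forall i j X Y, curvature L s i j X Y = 0.

Definition su3_instanton (R : realType) (L : nilpotent_lie_algebra R)
    (J : {linear 'rV[R]_6 -> 'rV[R]_6}) (g : 'rV[R]_6 -> 'rV[R]_6 -> R)
    (e : 'I_6 -> 'rV[R]_6) (s : 'rV[R]_6 -> 'M[R]_6) :=
  let O := curvature L s in let f k := e (ix k) in
  [/\ su3_connection J g e s,
      forall i j, O i j (f 1%N) (f 2%N) + O i j (f 3%N) (f 4%N)
                  + O i j (f 5%N) (f 6%N) = 0 &
      forall i j k l, O i j (J (e k)) (J (e l)) = O i j (e k) (e l)].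

Definition p1 (R : realType) (L : nilpotent_lie_algebra R)
    (s : 'rV[R]_6 -> 'M[R]_6) (X Y Z W : 'rV[R]_6) : R :=
  let O := curvature L s in
  (8 * pi ^+ 2)^-1 *
    \sum_(i < 6) \sum_(j < 6 | (i < j)%N) wedge22 (O i j) (O i j) X Y Z W.

(* T = J dF. *)
Definition torsion (R : realType) (L : nilpotent_lie_algebra R)
    (J : {linear 'rV[R]_6 -> 'rV[R]_6}) (g : 'rV[R]_6 -> 'rV[R]_6 -> R)
    (X Y Z : 'rV[R]_6) : R :=
  - d2 L (fundF J g) (J X) (J Y) (J Z).

(* g(nabla^g_X Y, Z) for the Levi-Civita connection and invariant vector fields
   X, Y, Z: Koszul's formula, in which the derivatives of the constant functions
   g(Y, Z) drop out. *)
Definition levi_civita (R : realType) (L : nilpotent_lie_algebra R)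
    (g : 'rV[R]_6 -> 'rV[R]_6 -> R) (X Y Z : 'rV[R]_6) : R :=
  2^-1 * (g (br L X Y) Z - g (br L Y Z) X + g (br L Z X) Y).

(* The connection forms s^i_j(X) = g(nabla_X e_j, e_i) of the Bismut
   connection. *)
Definition bismut (R : realType) (L : nilpotent_lie_algebra R)
    (J : {linear 'rV[R]_6 -> 'rV[R]_6}) (g : 'rV[R]_6 -> 'rV[R]_6 -> R)
    (e : 'I_6 -> 'rV[R]_6) (X : 'rV[R]_6) : 'M[R]_6 :=
  \matrix_(i, j) (levi_civita L g X (e j) (e i)
                  + 2^-1 * torsion L J g X (e j) (e i)).

(* The velocity of a curve in G, translated to the Lie algebra by the left
   translation by c(t)^-1. *)
Definition velocity (R : realType) (L : nilpotent_lie_algebra R)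
    (c : R -> 'rV[R]_6) (t : R) : 'rV[R]_6 :=
  derive1 (fun u : R => gmul L (ginv (c t)) (c u)) t.

(* The holonomy group of an invariant connection on M at the class of p, as a
   group of matrices in the frame e.  Loops in M based there lift to curves in G
   from p to h p with h in the lattice, and the columns of A are parallel along
   the curve: A' = - s(c') A.  Requiring curves defined on all of R, and of
   class C^1 instead of piecewise C^1, does not change the group: a curve on
   [0, 1] extends, and corners are removed by reparametrization. *)
Definition holonomy (R : realType) (M : nilmanifold R)
    (s : 'rV[R]_6 -> 'M[R]_6) (p : 'rV[R]_6) : set 'M[R]_6 :=
  [set B | exists (c : R -> 'rV[R]_6) (A : R -> 'M[R]_6),
    [/\ (forall t, derivable c t 1) /\ continuous (derive1 c),
        c 0 = p,
        exists2 h, lattice M h & c 1 = gmul M h p,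
        A 0 = 1%:M /\ A 1 = B &
        forall t : R, 0 <= t <= 1 -> forall i j,
          is_derive t 1 (fun u : R => A u i j)
            (- (s (velocity M c t) *m A t) i j)]].

Definition SU3 (R : realType) (J : {linear 'rV[R]_6 -> 'rV[R]_6})
    (g : 'rV[R]_6 -> 'rV[R]_6 -> R) (e : 'I_6 -> 'rV[R]_6) : set 'M[R]_6 :=
  let F := fundF J g in let P := Psi g e in
  [set B | let b := endo g e B in
     (forall X Y, F (b X) (b Y) = F X Y) /\
     (forall X Y Z, P (b X) (b Y) (b Z) = P X Y Z)].

Definition anomaly_cancellation (R : realType) (L : nilpotent_lie_algebra R)
    (J : {linear 'rV[R]_6 -> 'rV[R]_6}) (g : 'rV[R]_6 -> 'rV[R]_6 -> R)
    (s A : 'rV[R]_6 -> 'M[R]_6) :=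
  exists2 alpha : R, 0 < alpha & forall X Y Z W,
    d3 L (torsion L J g) X Y Z W
    = 2 * pi ^+ 2 * alpha * (p1 L s X Y Z W - p1 L A X Y Z W).

Definition strominger_solution (R : realType) (M : nilmanifold R)
    (J : {linear 'rV[R]_6 -> 'rV[R]_6}) (g : 'rV[R]_6 -> 'rV[R]_6 -> R)
    (e : 'I_6 -> 'rV[R]_6) (A : {linear 'rV[R]_6 -> 'M[R]_6}) :=
  [/\ hermitian_structure M J g /\ adapted_frame J g e,
      forall p, holonomy M (bismut M J g e) p `<=` SU3 J g e,
      balanced M J g,
      su3_instanton M J g e A /\ ~ flat M A &
      anomaly_cancellation M J g (bismut M J g e) A].

Definition heterotic_solution (R : realType) (M : nilmanifold R)
    (J : {linear 'rV[R]_6 -> 'rV[R]_6}) (g : 'rV[R]_6 -> 'rV[R]_6 -> R)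
    (e : 'I_6 -> 'rV[R]_6) (A : {linear 'rV[R]_6 -> 'M[R]_6}) :=
  strominger_solution M J g e A /\ su3_instanton M J g e (bismut M J g e).

(* h_3, written in the basis of 'rV[R]_6 dual to the coordinates e^1, ..., e^6:
   de^i = 0 for i < 6, and de^6 = e^12 + e^34, that is,
   e^6([X, Y]) = - (e^12 + e^34)(X, Y). *)
Definition h3_br (R : realType) (X Y : 'rV[R]_6) : 'rV[R]_6 :=
  let x k := fun Z : 'rV[R]_6 => Z 0 (ix k) in
  - (wedge11 (x 1%N) (x 2%N) X Y + wedge11 (x 3%N) (x 4%N) X Y)
    *: delta_mx 0 (ix 6).

Lemma h3_linearl (R : realType) (Y : 'rV[R]_6) : linear (@h3_br R ^~ Y).
Proof.
move=> a X X'; rewrite /h3_br /wedge11 !mxE scalerA -scalerDl; congr (_ *: _).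
by ring.
Qed.

Lemma h3_linearr (R : realType) (X : 'rV[R]_6) : linear (@h3_br R X).
Proof.
move=> a Y Y'; rewrite /h3_br /wedge11 !mxE scalerA -scalerDl; congr (_ *: _).
by ring.
Qed.

Lemma h3_alternating (R : realType) (X : 'rV[R]_6) : h3_br X X = 0.
Proof. by rewrite /h3_br /wedge11 !subrr addr0 oppr0 scale0r. Qed.

Lemma h3_2step (R : realType) (X Y Z : 'rV[R]_6) : h3_br X (h3_br Y Z) = 0.
Proof.
have n6 k : (0 < k < 6)%N -> (ix k == ix 6) = false.
  case: k => // k /= lek; apply/eqP => /(congr1 val) /=.
  rewrite !inordK //; last exact: ltnW.
  by move=> /= k5; move: lek; rewrite k5.
rewrite [LHS]/h3_br /wedge11 /h3_br !mxE !n6 // !andbF.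
by rewrite !(mulr0, mul0r, subrr, addr0, oppr0, scale0r).
Qed.

Lemma h3_jacobi (R : realType) (X Y Z : 'rV[R]_6) :
  h3_br X (h3_br Y Z) + h3_br Y (h3_br Z X) + h3_br Z (h3_br X Y) = 0.
Proof. by rewrite !h3_2step !addr0. Qed.

Lemma h3_nilpotent (R : realType) :
  exists n : nat, forall (Y : 'rV[R]_6) (s : seq 'rV[R]_6),
    size s = n -> foldr (@h3_br R) Y s = 0.
Proof. by exists 2%N => Y [|X [|X' []]] //= _; rewrite h3_2step. Qed.

Definition h3 (R : realType) : nilpotent_lie_algebra R :=
  NilpotentLieAlgebra (@h3_linearl R) (@h3_linearr R) (@h3_alternating R)
    (@h3_jacobi R) (h3_nilpotent R).

(* Differentiable homomorphisms of Lie groups are smooth. *)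
Definition lie_group_isomorphic (R : realType)
    (L L' : nilpotent_lie_algebra R) :=
  exists phi psi : 'rV[R]_6 -> 'rV[R]_6,
    [/\ cancel phi psi /\ cancel psi phi,
        forall x, differentiable phi x,
        forall x, differentiable psi x &
        forall x y, phi (gmul L x y) = gmul L' (phi x) (phi y)].

(* H x R is the simply-connected group with Lie algebra h_3; an isomorphism
   G -> H x R takes the lattice of M to a lattice of H x R. *)
Definition quotient_of_HxR (R : realType) (M : nilmanifold R) :=
  lie_group_isomorphic M (h3 R).

(* Main.v *)
Require Import Defs.
From HB Require Import structures.
From mathcomp Require Import all_boot all_order all_algebra.
From mathcomp Require Import ring lra complex.
From mathcomp Require Import all_classical reals topology normedtype derive.
From mathcomp Require Import sequences trigo.

Set Implicit Arguments.
Unset Strict Implicit.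
Unset Printing Implicit Defensive.

Import Order.TTheory GRing.Theory Num.Theory.
Import numFieldNormedType.Exports.

Local Open Scope ring_scope.

(** The theorem rests on a normal form for the bracket.  Nilpotency and
    [JX, Y] = - [X, JY] give a flag of J-stable ideals of dimensions 2, 4, 6,
    with every step central modulo the previous one; an orthonormal frame f
    adapted to it, with J f_1 = - f_2 and so on, is built in [exists_flag].
    Evaluating d(F /\ F) = 0 on this frame leaves
      [X, Y] = alpha(X, Y) f_5 + beta(X, Y) f_6,
    where alpha and beta are primitive (1,1)-forms on the span of f_1, ..., f_4,
    that is, anti-self-dual forms with coordinates p, q in R^3
    ([exists_structure_frame]).

    For abelian J the torsion cancels two of the three terms of Koszul's
    formula, and the connection forms of the Bismut connection are
    g([e_i, e_j], X) ([bismutE]).  With a_ij = alpha(e_i, e_j) and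
    b_ij = beta(e_i, e_j), its curvature is
      - (a_ij alpha + b_ij beta) + [a, b]_ij f^5 /\ f^6
    ([curvature_bismut]).  The matrices a and b lie in su(3), because alpha and
    beta are J-invariant and primitive; hence the Bismut connection preserves F
    and Psi, and so does its parallel transport ([holonomy_su3]).

    Existence.  Both dT and the Pontrjagin forms are multiples of the volume
    form of the span of f_1, ..., f_4: dT has the coefficient
    - 2 (|p|^2 + |q|^2), and the sum in p_1 for the Bismut connection has
    - 2 S with S > 0 a sum of squares.  A connection X |-> c g(V, X) B with a
    fixed B in su(3) and V a nonzero bracket is a non-flat instanton whose sum is
    - 4 c^2 |m|^2 with m <> 0.  For small c the difference has the sign of dT,
    and the quotient is the required positive constant
    ([exists_anomaly_free]).

    Equations of motion.  The forms alpha and beta are primitive while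
    f^5 /\ f^6 is not, so the Bismut connection is an instanton exactly when
    [a, b] = 0 ([instanton_commutator]).  In su(2) = R^3 this means that p and q
    are parallel, that is, that the derived algebra is a line.  A nonzero
    anti-self-dual form has rank 4, so Darboux coordinates then identify the
    algebra with h_3 ([darboux_h3]).  Conversely, a differentiable isomorphism of
    2-step groups in exponential coordinates is linear
    ([lie_group_hom_linear]) and so an isomorphism of Lie algebras, and the
    derived algebra of h_3 is a line. *)

(** * Indices, and inner products on R^6 *)

Lemma eq_ix (a b : nat) : (0 < a <= 6)%N -> (0 < b <= 6)%N ->
  (ix a == ix b) = (a == b).
Proof.
case: a b => [|a] [|b] //= a6 b6.
by rewrite /ix -val_eqE /= !inordK.
Qed.

Lemma sum6 (V : nmodType) (F : 'I_6 -> V) :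
  \sum_i F i = F (ix 1) + F (ix 2) + F (ix 3) + F (ix 4) + F (ix 5) + F (ix 6).
Proof.
rewrite !big_ord_recl big_ord0 addr0 !addrA.
by do ![congr (_ + _)]; congr F; apply: val_inj; rewrite /= inordK.
Qed.

Lemma ord6P (P : 'I_6 -> Prop) :
  P (ix 1) -> P (ix 2) -> P (ix 3) -> P (ix 4) -> P (ix 5) -> P (ix 6) ->
  forall i, P i.
Proof.
move=> P1 P2 P3 P4 P5 P6 i; have -> : i = ix i.+1.
  by apply: val_inj; rewrite /= inordK ?ltn_ord.
by case: i => [[|[|[|[|[|[|m]]]]]] im].
Qed.

Lemma scalar_eq0 (R : realType) (f : 'rV[R]_6 -> R) : scalar f -> f 0 = 0.
Proof. by move=> flin; have := flin (-1) 0 0; rewrite scaler0 addr0 mulN1r addNr. Qed.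

Lemma scalar_opp (R : realType) (f : 'rV[R]_6 -> R) X : scalar f ->
  f (- X) = - f X.
Proof.
move=> flin; have := flin (-1) X 0.
by rewrite addr0 scaleN1r (scalar_eq0 flin) addr0 mulN1r.
Qed.

Section InnerProduct.
Variables (R : realType) (g : 'rV[R]_6 -> 'rV[R]_6 -> R).
Hypothesis gP : inner_product g.
Implicit Types X Y Z W : 'rV[R]_6.

Lemma ipC X Y : g X Y = g Y X. Proof. by case: gP. Qed.

Lemma ip_scalar X : scalar (g X). Proof. by case: gP => + _ _ a Y Z; apply. Qed.

Lemma ipDr X Y Z : g X (Y + Z) = g X Y + g X Z.
Proof. by rewrite -{1}[Y]scale1r ip_scalar mul1r. Qed.

Lemma ip0r X : g X 0 = 0.
Proof. by have := ipDr X 0 0; rewrite addr0 -{1}[g X 0]addr0 => /addrI. Qed.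

Lemma ipZr X a Y : g X (a *: Y) = a * g X Y.
Proof. by rewrite -[a *: Y]addr0 ip_scalar ip0r addr0. Qed.

Lemma ipNr X Y : g X (- Y) = - g X Y.
Proof. by rewrite -scaleN1r ipZr mulN1r. Qed.

Lemma ipDl X Y Z : g (X + Y) Z = g X Z + g Y Z.
Proof. by rewrite ![g _ Z]ipC ipDr. Qed.

Lemma ip0l X : g 0 X = 0. Proof. by rewrite ipC ip0r. Qed.

Lemma ipZl a X Y : g (a *: X) Y = a * g X Y.
Proof. by rewrite ![g _ Y]ipC ipZr. Qed.

Lemma ipNl X Y : g (- X) Y = - g X Y.
Proof. by rewrite ![g _ Y]ipC ipNr. Qed.

Lemma ip_sumr I (r : seq I) (P : pred I) X (Y : I -> 'rV_6) :
  g X (\sum_(i <- r | P i) Y i) = \sum_(i <- r | P i) g X (Y i).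
Proof. by apply: (big_morph (g X)); [exact: ipDr | exact: ip0r]. Qed.

Lemma ip_gt0 X : X != 0 -> 0 < g X X. Proof. by case: gP => _ _; apply. Qed.

Lemma ip_eq0 X : g X X = 0 -> X = 0.
Proof.
by move=> g0; apply/eqP; apply: contraT => /ip_gt0; rewrite g0 ltxx.
Qed.

Lemma ip_inj X Y : (forall Z, g Z X = g Z Y) -> X = Y.
Proof.
move=> eqXY; apply/eqP; rewrite -subr_eq0; apply/eqP/ip_eq0.
by rewrite ipDr ipNr eqXY subrr.
Qed.

Lemma scalar_sum (f : 'rV[R]_6 -> R) I (r : seq I) (c : I -> R)
    (v : I -> 'rV_6) : scalar f ->
  f (\sum_(i <- r) c i *: v i) = \sum_(i <- r) c i * f (v i).
Proof.
move=> flin; elim: r => [|i r IH]; last by rewrite !big_cons flin IH.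
rewrite !big_nil; have := flin 1 0 0; rewrite mul1r scaler0 addr0.
by rewrite -{1}[f 0]addr0 => /addrI.
Qed.

Definition orthonormal (e : 'I_6 -> 'rV[R]_6) :=
  forall i j, g (e i) (e j) = (i == j)%:R.

Section Frame.
Variable e : 'I_6 -> 'rV[R]_6.
Hypothesis eP : orthonormal e.

(** If E has rows e_i and G is the Gram matrix of g, orthonormality reads
    E (G E^T) = 1; square matrices commute with their inverses, and
    (G E^T) E = 1 is the expansion.  In the proof [G] stands for G E^T. *)
Lemma frame_expand X : X = \sum_i g (e i) X *: e i.
Proof.
pose E := \matrix_i e i; pose G := \matrix_(j, i) g (e i) (delta_mx 0 j).
have coords Y i : g (e i) Y = (Y *m G) 0 i.
  rewrite {1}[Y]row_sum_delta scalar_sum ?mxE; last exact: ip_scalar.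
  by apply: eq_bigr => j _; rewrite mxE.
have EG : E *m G = 1%:M.
  apply/matrixP => i j; rewrite [RHS]mxE eq_sym -eP coords !mxE.
  by apply: eq_bigr => k _; rewrite !mxE.
rewrite -{1}[X]mulmx1 -(mulmx1C EG) mulmxA mulmx_sum_row.
by apply: eq_bigr => i _; rewrite -coords rowK.
Qed.

Lemma frame_ip X Y : g X Y = \sum_i g (e i) X * g (e i) Y.
Proof.
rewrite [in LHS](frame_expand Y) ip_sumr; apply: eq_bigr => i _.
by rewrite ipZr mulrC (ipC X).
Qed.

Lemma frame_scalar (f : 'rV[R]_6 -> R) X : scalar f ->
  f X = \sum_i g (e i) X * f (e i).
Proof. by move=> flin; rewrite [in LHS](frame_expand X) scalar_sum. Qed.

Lemma frame_bilinear_eq0 (B : 'rV[R]_6 -> 'rV[R]_6 -> R) :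
    (forall Y, scalar (B^~ Y)) -> (forall X, scalar (B X)) ->
  (forall i j, B (e i) (e j) = 0) -> forall X Y, B X Y = 0.
Proof.
move=> Bl Br B0 X Y; rewrite (frame_scalar X (Bl Y)) big1 // => i _.
by rewrite (frame_scalar Y (Br _)) big1 ?mulr0 // => j _; rewrite B0 mulr0.
Qed.

End Frame.

(** Both sides are the trace of B with respect to g. *)
Lemma bilinear_trace (e f : 'I_6 -> 'rV[R]_6) (B : 'rV[R]_6 -> 'rV[R]_6 -> R) :
    orthonormal e -> orthonormal f ->
    (forall Y, scalar (B^~ Y)) -> (forall X, scalar (B X)) ->
  \sum_i B (f i) (f i) = \sum_i B (e i) (e i).
Proof.
move=> eP fP Bl Br.
transitivity
  (\sum_i \sum_j \sum_k g (e j) (f i) * (g (e k) (f i) * B (e j) (e k))).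
  apply: eq_bigr => i _; rewrite (frame_scalar eP (f i) (Bl (f i))).
  apply: eq_bigr => j _; rewrite [in LHS](frame_scalar eP (f i) (Br (e j))).
  by rewrite mulr_sumr.
rewrite exchange_big; apply: eq_bigr => j _; rewrite exchange_big /=.
transitivity (\sum_k g (e j) (e k) * B (e j) (e k)); last first.
  rewrite (bigD1 j) //= eP eqxx mul1r big1 ?addr0 // => k kj.
  by rewrite eP eq_sym (negPf kj) mul0r.
apply: eq_bigr => k _; rewrite (frame_ip fP) mulr_suml.
by apply: eq_bigr => i _; rewrite (ipC (f i)) (ipC (f i)) mulrA.
Qed.

End InnerProduct.

(** * Flags of J-stable ideals *)
HB.instance Definition _ (R : realType) (L : nilpotent_lie_algebra R) X :=
  GRing.isLinear.Build R 'rV[R]_6 'rV[R]_6 *:%R (br L X) (br_linearr L X).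

Section Bracket.
Variables (R : realType) (L : nilpotent_lie_algebra R).
Implicit Types X Y : 'rV[R]_6.

Lemma brDl X X' Y : br L (X + X') Y = br L X Y + br L X' Y.
Proof. by have := br_linearl L Y 1 X X'; rewrite /= !scale1r. Qed.

Lemma brDr X Y Y' : br L X (Y + Y') = br L X Y + br L X Y'.
Proof. exact: linearD. Qed.

Lemma brZr a X Y : br L X (a *: Y) = a *: br L X Y.
Proof. exact: linearZ. Qed.

Lemma brNr X Y : br L X (- Y) = - br L X Y.
Proof. exact: linearN. Qed.

Lemma br0r X : br L X 0 = 0.
Proof. exact: linear0. Qed.

Lemma br_sumr I (r : seq I) X (Y : I -> 'rV_6) :
  br L X (\sum_(i <- r) Y i) = \sum_(i <- r) br L X (Y i).
Proof. exact: linear_sum. Qed.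

Lemma brC X Y : br L X Y = - br L Y X.
Proof.
apply/eqP; rewrite -addr_eq0; apply/eqP.
have := br_alternating L (X + Y).
by rewrite brDl !linearD /= !br_alternating add0r addr0.
Qed.

Lemma brZl a X Y : br L (a *: X) Y = a *: br L X Y.
Proof. by rewrite brC linearZ /= -scalerN -(brC X). Qed.

Lemma br0l Y : br L 0 Y = 0.
Proof. by rewrite brC linear0 oppr0. Qed.

(** A longest iterated bracket outside a is brought into a by one more
    bracket. *)
Lemma exists_central_mod (a : 'rV[R]_6 -> Prop) : a 0 -> (exists X, ~ a X) ->
  exists2 Y, ~ a Y & forall X, a (br L X Y).
Proof.
move=> a0 [X0 aX0]; have [n nil] := br_nilpotent L.
have : forall (Y : 'rV[R]_6) s, size s = n -> a (foldr (br L) Y s).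
  by move=> Y s /nil ->.
elim: n {nil} => [|n IH] an; first by case: (aX0 (an X0 [::] erefl)).
have [/IH //|] := pselect (forall (Y : 'rV[R]_6) s,
  size s = n -> a (foldr (br L) Y s)).
move=> /existsNP[Y /existsNP[s /not_implyP[sn aYs]]].
by exists (foldr (br L) Y s) => // X; apply: (an Y (X :: s)); rewrite /= sn.
Qed.

End Bracket.

Section Flag.
Variables (R : realType) (L : nilpotent_lie_algebra R).
Variables (J : {linear 'rV[R]_6 -> 'rV[R]_6}) (g : 'rV[R]_6 -> 'rV[R]_6 -> R).
Hypothesis hermJ : hermitian_structure L J g.
Hypothesis abJ : abelian_complex_structure L J.
Implicit Types (X Y v w : 'rV[R]_6) (s : seq 'rV[R]_6).

Let gP : inner_product g. Proof. by case: hermJ. Qed.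

Lemma JJ X : J (J X) = - X. Proof. by case: hermJ => -[]. Qed.

Lemma ipJ X Y : g (J X) Y = - g X (J Y).
Proof. by case: hermJ => _ _ gJ; rewrite -gJ JJ (ipNl gP). Qed.

Lemma ip_XJX X : g X (J X) = 0.
Proof. by have := ipJ X X; rewrite (ipC gP); lra. Qed.

Lemma br_XJY X Y : br L X (J Y) = - br L (J X) Y.
Proof. by rewrite -abJ JJ linearN. Qed.

(** For an orthonormal list this is membership in the span: the right-hand side
    is then the orthogonal projection of X. *)
Definition in_span s X := X = \sum_(v <- s) g v X *: v.

Definition orthonormal_seq s :=
  uniq s /\ {in s &, forall v w, g v w = (v == w)%:R}.

Lemma in_span_linear s a X Y :
  in_span s X -> in_span s Y -> in_span s (a *: X + Y).
Proof.
rewrite /in_span => sX sY; rewrite [in LHS]sX [in LHS]sY scaler_sumr -big_split.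
by apply: eq_bigr => v _; rewrite /= ip_scalar // scalerDl scalerA.
Qed.

Lemma in_span0 s : in_span s 0.
Proof. by rewrite /in_span big1 // => v _; rewrite ip0r ?scale0r. Qed.

Lemma in_spanZ s a X : in_span s X -> in_span s (a *: X).
Proof.
by move=> sX; rewrite -[a *: X]addr0; apply: in_span_linear (in_span0 _).
Qed.

Lemma in_span_sum s (r : seq 'rV[R]_6) (c : 'rV[R]_6 -> R) (X : 'rV_6 -> 'rV_6) :
  (forall v, v \in r -> in_span s (X v)) ->
  in_span s (\sum_(v <- r) c v *: X v).
Proof.
elim: r => [|v r IH] sX; first by rewrite big_nil; exact: in_span0.
rewrite big_cons; apply: in_span_linear; first exact/sX/mem_head.
by apply: IH => w rw; apply: sX; rewrite inE rw orbT.
Qed.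

Lemma in_span_orth s w X : (forall v, v \in s -> g w v = 0) -> in_span s X ->
  g w X = 0.
Proof.
move=> ws ->; rewrite ip_sumr // big_seq big1 // => v /ws wv.
by rewrite ipZr // wv mulr0.
Qed.

Lemma ip_proj s v (c : 'rV[R]_6 -> R) : orthonormal_seq s -> v \in s ->
  g v (\sum_(w <- s) c w *: w) = c v.
Proof.
move=> [us os] vs; rewrite ip_sumr // (bigD1_seq v) //= ipZr // os // eqxx mulr1.
rewrite big_seq_cond big1 ?addr0 // => w /andP[ws wv].
by rewrite ipZr // os // eq_sym (negPf wv) mulr0.
Qed.

Lemma in_span_mem s v : orthonormal_seq s -> v \in s -> in_span s v.
Proof.
move=> [us os] vs; rewrite /in_span (bigD1_seq v) //= os // eqxx scale1r.
rewrite big_seq_cond big1 ?addr0 // => w /andP[ws wv].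
by rewrite os // (negPf wv) scale0r.
Qed.

(** If the list spanned everything, the sum of g(v, e_i)^2 over both families
    would be 6 as well as the length of the list. *)
Lemma not_in_span s (e : 'I_6 -> 'rV[R]_6) : orthonormal g e ->
  orthonormal_seq s -> (size s < 6)%N -> exists X, ~ in_span s X.
Proof.
move=> eP sP s6; apply/existsNP => all_s.
have : \sum_i g (e i) (e i) = \sum_(v <- s) g v v.
  transitivity (\sum_i \sum_(v <- s) g (e i) v * g (e i) v).
    apply: eq_bigr => i _; rewrite {2}(all_s (e i)) ip_sumr //.
    by apply: eq_bigr => v _; rewrite ipZr // (ipC gP v).
  by rewrite exchange_big; apply: eq_bigr => v _; rewrite -(frame_ip gP eP).
under eq_bigr do rewrite eP eqxx.
have [_ os] := sP; rewrite [RHS]big_seq.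
under [RHS]eq_bigr => v vs do rewrite os // eqxx.
rewrite -big_seq !sumr_const card_ord big_const_seq count_predT.
rewrite iter_addr_0 => /eqP; rewrite eqr_nat => /eqP s6'.
by rewrite -s6' ltnn in s6.
Qed.

Definition J_stable_ideal s :=
  forall v, v \in s -> in_span s (J v) /\ forall X, in_span s (br L X v).

(** A vector that is central modulo the span stays so when its projection to the
    span is subtracted, because the span is an ideal. *)
Lemma exists_next s (e : 'I_6 -> 'rV[R]_6) : orthonormal g e ->
    orthonormal_seq s -> J_stable_ideal s -> (size s < 6)%N ->
  exists Y, [/\ g Y Y = 1, forall v, v \in s -> g v Y = 0 &
    forall X, in_span s (br L X Y)].
Proof.
move=> eP sP sJ s6.
have [Y nY brY] :=
  exists_central_mod L (in_span0 s) (not_in_span eP sP s6).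
pose P := \sum_(v <- s) g v Y *: v; pose Z := Y - P.
have Z0 : Z != 0.
  by apply/eqP => /subr0_eq.
have brZ X : in_span s (br L X Z).
  rewrite /Z -scaleN1r addrC brDr brZr; apply: in_span_linear => //.
  rewrite br_sumr; under eq_bigr do rewrite brZr.
  by apply: (@in_span_sum s s (g^~ Y) (br L X)) => v /sJ[].
have sZ v : v \in s -> g v Z = 0.
  by move=> vs; rewrite ipDr // ipNr // ip_proj // subrr.
have ZZ := ip_gt0 gP Z0.
pose c := (Num.sqrt (g Z Z))^-1.
have cc : c * c * g Z Z = 1.
  rewrite -expr2 exprVn sqr_sqrtr ?ltW // mulVf //.
  by rewrite gt_eqF.
exists (c *: Z); split=> [|v vs|X].
- by rewrite ipZr // ipZl // mulrA.
- by rewrite ipZr // sZ ?mulr0.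
- by rewrite brZr; apply: in_spanZ.
Qed.

(** The vector - JY is as central modulo the span as Y is, because
    [X, JY] = - [JX, Y]; it is orthogonal to Y because J is skew. *)
Lemma extend_flag s Y : orthonormal_seq s -> J_stable_ideal s ->
    g Y Y = 1 -> (forall v, v \in s -> g v Y = 0) ->
    (forall X, in_span s (br L X Y)) ->
  orthonormal_seq [:: Y, - J Y & s] /\ J_stable_ideal [:: Y, - J Y & s].
Proof.
move=> sP sJ YY sY brY.
have sJY v : v \in s -> g v (- J Y) = 0.
  move=> vs; rewrite ipNr // -ipJ (ipC gP).
  by apply: in_span_orth (sJ v vs).1 => w /sY; rewrite (ipC gP).
have YJY : g Y (- J Y) = 0 by rewrite ipNr // ip_XJX oppr0.
have JYJY : g (- J Y) (- J Y) = 1.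
  by rewrite ipNr // ipNl // opprK; case: hermJ => _ _ ->.
have YNs : Y \notin s.
  by apply/negP => /sY /eqP; rewrite YY oner_eq0.
have JYNs : - J Y \notin s.
  by apply/negP => /sJY /eqP; rewrite JYJY oner_eq0.
have YNJY : Y != - J Y.
  by apply/eqP => E; move: YJY; rewrite -E YY => /eqP; rewrite oner_eq0.
have sP' : orthonormal_seq [:: Y, - J Y & s].
  have [us os] := sP; split; first by rewrite /= inE negb_or YNJY YNs JYNs us.
  have eq_Y v : v \in s -> (v == Y) = false.
    by move=> vs; apply: contraNF YNs => /eqP <-.
  have eq_JY v : v \in s -> (v == - J Y) = false.
    by move=> vs; apply: contraNF JYNs => /eqP <-.
  move=> v w; rewrite !inE => /or3P[/eqP->|/eqP->|vs] /or3P[/eqP->|/eqP->|ws].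
  - by rewrite YY eqxx.
  - by rewrite YJY (negPf YNJY).
  - by rewrite (ipC gP) sY // eq_sym eq_Y.
  - by rewrite (ipC gP) YJY eq_sym (negPf YNJY).
  - by rewrite JYJY eqxx.
  - by rewrite (ipC gP) sJY // eq_sym eq_JY.
  - by rewrite sY // eq_Y.
  - by rewrite sJY // eq_JY.
  - by rewrite os.
have wider X : in_span s X -> in_span [:: Y, - J Y & s] X.
  move=> sX; rewrite /in_span !big_cons.
  have -> : g Y X = 0.
    by apply: in_span_orth sX => v /sY; rewrite (ipC gP).
  have -> : g (- J Y) X = 0.
    by apply: in_span_orth sX => v /sJY; rewrite (ipC gP).
  by rewrite !scale0r !add0r.
split=> // v; rewrite !inE => /or3P[/eqP->|/eqP->|vs].
- split=> [|X]; last exact/wider/brY.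
  suff : in_span [:: Y, - J Y & s] (-1 *: - J Y) by rewrite scaleN1r opprK.
  by apply: in_spanZ; apply: in_span_mem => //; rewrite !inE eqxx orbT.
- split=> [|X].
    by rewrite linearN JJ opprK; apply: in_span_mem; rewrite // mem_head.
  by rewrite brNr br_XJY opprK; apply/wider/brY.
- by have [sJv brv] := sJ v vs; split=> [|X]; apply: wider.
Qed.

Definition unitary (f : 'I_6 -> 'rV[R]_6) := orthonormal g f /\
  [/\ J (f (ix 1)) = - f (ix 2), J (f (ix 3)) = - f (ix 4)
    & J (f (ix 5)) = - f (ix 6)].

Lemma exists_flag (e : 'I_6 -> 'rV[R]_6) : orthonormal g e ->
  exists2 f, unitary f &
    forall X, [/\ br L X (f (ix 5)) = 0,
      forall k, (0 < k <= 4)%N -> g (f (ix k)) (br L X (f (ix 3))) = 0 &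
      forall k, (0 < k <= 2)%N -> g (f (ix k)) (br L X (f (ix 1))) = 0].
Proof.
move=> eP.
have nilP : orthonormal_seq [::] by split.
have nilJ : J_stable_ideal [::] by [].
have [Y5 [u5 o5 br5]] := exists_next eP nilP nilJ isT.
have [P5 J5] := extend_flag nilP nilJ u5 o5 br5.
have [Y3 [u3 o3 br3]] := exists_next eP P5 J5 isT.
have [P3 J3] := extend_flag P5 J5 u3 o3 br3.
have [Y1 [u1 o1 br1]] := exists_next eP P3 J3 isT.
have [P1 J1] := extend_flag P3 J3 u1 o1 br1.
set s := [:: Y1, _ & _] in P1.
pose f (i : 'I_6) := nth 0 s i.
have fE k : (k < 6)%N -> f (ix k.+1) = nth 0 s k by move=> k6; rewrite /f /= inordK.
have [us os] := P1.
have ON : orthonormal g f.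
  move=> i j; have ms k : f k \in s by apply: mem_nth; exact: (ltn_ord k).
  rewrite (os _ _ (ms i) (ms j)) /f.
  congr (_%:R); congr nat_of_bool.
  by apply: nth_uniq us; exact: ltn_ord.
have orth n k X : (k < n)%N -> (n <= 6)%N -> in_span (drop n s) X ->
    g (f (ix k.+1)) X = 0.
  move=> kn n6; apply: in_span_orth => v /(nthP 0)[m].
  rewrite size_drop ltn_subRL => nm <-; have k6 := leq_trans kn n6.
  rewrite nth_drop fE // os ?mem_nth // nth_uniq // ltn_eqF //.
  by rewrite ltn_addr.
exists f; first by split=> //; rewrite !fE // !opprK.
move=> X; rewrite !fE //=; split.
- by rewrite [LHS]br5 big_nil.
- by move=> [//|k] k4; apply: (orth 4%N) (br3 X).
- by move=> [//|k] k2; apply: (orth 2%N) (br1 X).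
Qed.

End Flag.

(** * The normal form of the bracket *)
Section Structure.
Variables (R : realType) (L : nilpotent_lie_algebra R).
Variables (J : {linear 'rV[R]_6 -> 'rV[R]_6}) (g : 'rV[R]_6 -> 'rV[R]_6 -> R).
Hypothesis hermJ : hermitian_structure L J g.
Hypothesis abJ : abelian_complex_structure L J.
Implicit Types (X Y : 'rV[R]_6) (f : 'I_6 -> 'rV[R]_6).

Let gP : inner_product g. Proof. by case: hermJ. Qed.

Lemma unitaryJ f : unitary J g f ->
  [/\ J (f (ix 2)) = f (ix 1), J (f (ix 4)) = f (ix 3)
    & J (f (ix 6)) = f (ix 5)].
Proof.
have swap Y Z : J Y = - Z -> J Z = Y.
  by move=> JY; rewrite -[Z]opprK -JY linearN (JJ hermJ) opprK.
by case=> _ [/swap ? /swap ? /swap ?].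
Qed.

(** The anti-self-dual forms on the span of f_1, ..., f_4, which are its
    primitive (1,1)-forms for F; r holds the coordinates in the basis
    f^12 - f^34, f^13 + f^24, f^14 - f^23. *)
Definition asd f (r : R * R * R) X Y : R :=
  let x k := coframe g f (ix k) in
  r.1.1 * (wedge11 (x 1%N) (x 2%N) X Y - wedge11 (x 3%N) (x 4%N) X Y)
  + r.1.2 * (wedge11 (x 1%N) (x 3%N) X Y + wedge11 (x 2%N) (x 4%N) X Y)
  + r.2 * (wedge11 (x 1%N) (x 4%N) X Y - wedge11 (x 2%N) (x 3%N) X Y).

Definition structure_frame f p q :=
  unitary J g f /\
  forall X Y, br L X Y = asd f p X Y *: f (ix 5) + asd f q X Y *: f (ix 6).

(** The flag puts all brackets of frame vectors into the span of f_5 and f_6,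
    except that [f_1, f_2] may have components along f_3 and f_4.  The balanced
    condition, evaluated on five of the six frame vectors at a time, removes
    these and gives [f_1, f_2] + [f_3, f_4] = 0.  Invariance of the bracket under
    J gives [f_2, f_4] = [f_1, f_3] and [f_2, f_3] = - [f_1, f_4]. *)
Lemma exists_structure_frame (e : 'I_6 -> 'rV[R]_6) :
  orthonormal g e -> balanced L J g -> exists f p q, structure_frame f p q.
Proof.
move=> eP bal; have [f fU flag] := exists_flag hermJ abJ eP.
have [fP [J1 J3 J5]] := fU; have [J2 J4 J6] := unitaryJ fU.
have br5 X : br L X (f (ix 5)) = 0 by case: (flag X).
have br3 X k : (0 < k <= 4)%N -> g (f (ix k)) (br L X (f (ix 3))) = 0.
  by case: (flag X) => _ + _; apply.
have br1 X k : (0 < k <= 2)%N -> g (f (ix k)) (br L X (f (ix 1))) = 0.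
  by case: (flag X) => _ _; apply.
have br6 X : br L X (f (ix 6)) = 0.
  by rewrite -[f (ix 6)]opprK -J5 brNr (br_XJY hermJ abJ) br5 !oppr0.
have br4 X k : (0 < k <= 4)%N -> g (f (ix k)) (br L X (f (ix 4))) = 0.
  by move=> k4; rewrite -[f (ix 4)]opprK -J3 brNr (br_XJY hermJ abJ) opprK br3.
have br2 X k : (0 < k <= 2)%N -> g (f (ix k)) (br L X (f (ix 2))) = 0.
  by move=> k4; rewrite -[f (ix 2)]opprK -J1 brNr (br_XJY hermJ abJ) opprK br1.
have b5r X : br L (f (ix 5)) X = 0 by rewrite brC br5 oppr0.
have b6r X : br L (f (ix 6)) X = 0 by rewrite brC br6 oppr0.
have b24 : br L (f (ix 2)) (f (ix 4)) = br L (f (ix 1)) (f (ix 3)).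
  by rewrite -abJ J2 J4.
have b23 : br L (f (ix 2)) (f (ix 3)) = - br L (f (ix 1)) (f (ix 4)).
  by rewrite -abJ J2 J3 brNr.
pose F := (JJ hermJ, J1, J2, J3, J4, J5, J6, br5, br6, b5r, b6r, b24, b23,
  ipNr gP, ipNl gP, ip0l gP, ip0r gP, fP, eq_ix).
have bal6 : g (br L (f (ix 1)) (f (ix 2))) (f (ix 6))
    = - g (br L (f (ix 3)) (f (ix 4))) (f (ix 6)).
  have := bal (f (ix 1)) (f (ix 2)) (f (ix 3)) (f (ix 4)) (f (ix 5)).
  by rewrite /d4 /wedge22 /fundF !F //=; lra.
have bal5 : g (br L (f (ix 1)) (f (ix 2))) (f (ix 5))
    = - g (br L (f (ix 3)) (f (ix 4))) (f (ix 5)).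
  have := bal (f (ix 1)) (f (ix 2)) (f (ix 3)) (f (ix 4)) (f (ix 6)).
  by rewrite /d4 /wedge22 /fundF !F //=; lra.
have bal4 : g (br L (f (ix 1)) (f (ix 2))) (f (ix 4)) = 0.
  have b3 := br3 (f (ix 1)) 1%N isT; have b2 := br3 (f (ix 2)) 2%N isT.
  have := bal (f (ix 1)) (f (ix 2)) (f (ix 3)) (f (ix 5)) (f (ix 6)).
  move: b3 b2; rewrite !(ipC gP (f _) (br _ _ _)) /d4 /wedge22 /fundF.
  by rewrite !F //=; lra.
have bal3 : g (br L (f (ix 1)) (f (ix 2))) (f (ix 3)) = 0.
  have b3 := br4 (f (ix 1)) 1%N isT; have b2 := br4 (f (ix 2)) 2%N isT.
  have := bal (f (ix 1)) (f (ix 2)) (f (ix 4)) (f (ix 5)) (f (ix 6)).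
  move: b3 b2; rewrite !(ipC gP (f _) (br _ _ _)) /d4 /wedge22 /fundF.
  by rewrite !F //=; lra.
have inC Z : (forall k, (0 < k <= 4)%N -> g (f (ix k)) Z = 0) ->
    Z = g (f (ix 5)) Z *: f (ix 5) + g (f (ix 6)) Z *: f (ix 6).
  move=> Z4; rewrite {1}(frame_expand gP fP Z) sum6.
  rewrite (Z4 1%N) // (Z4 2%N) // (Z4 3%N) // (Z4 4%N) //.
  by rewrite !scale0r !add0r.
have b12 : br L (f (ix 1)) (f (ix 2)) =
    g (f (ix 5)) (br L (f (ix 1)) (f (ix 2))) *: f (ix 5)
    + g (f (ix 6)) (br L (f (ix 1)) (f (ix 2))) *: f (ix 6).
  apply: inC => k k4; have [k2|] := leqP k 2.
    by rewrite br2 //; case/andP: k4 => ->.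
  case: k k4 => [|[|[|[|[|k]]]]] //= _ _; first by rewrite (ipC gP).
  by rewrite (ipC gP).
have b13 := inC _ (br3 (f (ix 1))).
have b14 := inC _ (br4 (f (ix 1))).
have b34 : br L (f (ix 3)) (f (ix 4)) = - br L (f (ix 1)) (f (ix 2)).
  rewrite b12 {1}(inC _ (br4 (f (ix 3)))) !(ipC gP (f _) (br _ _ _)) bal5 bal6.
  by rewrite !scaleNr opprD !opprK.
pose c k i := g (f (ix k)) (br L (f (ix 1)) (f (ix i))).
rewrite -!/(c _ _) in b12 b13 b14.
exists f, (c 5%N 2%N, c 5%N 3%N, c 5%N 4%N), (c 6%N 2%N, c 6%N 3%N, c 6%N 4%N).
split=> // X Y.
rewrite {1}(frame_expand gP fP X) {1}(frame_expand gP fP Y).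
rewrite !sum6 !brDl !brDr !brZl !brZr !br5 !br6 !b5r !b6r.
rewrite !(br_alternating L).
rewrite ![br L (f (ix 2)) (f (ix 1))]brC ![br L (f (ix 3)) (f (ix 1))]brC.
rewrite ![br L (f (ix 3)) (f (ix 2))]brC ![br L (f (ix 4)) (f (ix 1))]brC.
rewrite ![br L (f (ix 4)) (f (ix 2))]brC ![br L (f (ix 4)) (f (ix 3))]brC.
rewrite b34 b24 b23 b12 b13 b14.
by apply/rowP => k; rewrite !mxE /asd /wedge11 /coframe /=; ring.
Qed.

End Structure.

(** * Primitive (1,1)-forms *)
Section TwoForms.
Variables (R : realType) (L : nilpotent_lie_algebra R).
Variables (J : {linear 'rV[R]_6 -> 'rV[R]_6}) (g : 'rV[R]_6 -> 'rV[R]_6 -> R).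
Hypothesis hermJ : hermitian_structure L J g.
Implicit Types (X Y Z W : 'rV[R]_6) (e f : 'I_6 -> 'rV[R]_6) (p q r : R * R * R).

Let gP : inner_product g. Proof. by case: hermJ. Qed.

Lemma coframeJ f X : unitary J g f ->
  [/\ g (f (ix 1)) (J X) = g (f (ix 2)) X, g (f (ix 2)) (J X) = - g (f (ix 1)) X,
      g (f (ix 3)) (J X) = g (f (ix 4)) X & g (f (ix 4)) (J X) = - g (f (ix 3)) X]
  /\ (g (f (ix 5)) (J X) = g (f (ix 6)) X /\ g (f (ix 6)) (J X) = - g (f (ix 5)) X).
Proof.
move=> fU; have [J2 J4 J6] := unitaryJ hermJ fU; have [_ [J1 J3 J5]] := fU.
have E Y : g Y (J X) = - g (J Y) X by rewrite (ipJ hermJ) opprK.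
by rewrite !E J1 J2 J3 J4 J5 J6 !(ipNl gP) !opprK.
Qed.

Lemma asd_scalarr f r X : scalar (asd g f r X).
Proof.
move=> a Y Z; rewrite /asd /wedge11 /coframe !(ip_scalar gP).
by case: r => [[r1 r2] r3] /=; ring.
Qed.

Lemma asdC f r X Y : asd g f r X Y = - asd g f r Y X.
Proof. by rewrite /asd /wedge11 /coframe; ring. Qed.

Lemma asd_scalarl f r Y : scalar (asd g f r ^~ Y).
Proof.
by move=> a X X' /=; rewrite asdC asd_scalarr (asdC _ _ X) (asdC _ _ X'); ring.
Qed.

Lemma asdJ f r X Y : unitary J g f -> asd g f r (J X) (J Y) = asd g f r X Y.
Proof.
move=> fU; rewrite /asd /wedge11 /coframe.
have [[-> -> -> ->] _] := coframeJ X fU; have [[-> -> -> ->] _] := coframeJ Y fU.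
ring.
Qed.

Definition vol4 f : 'rV[R]_6 -> 'rV[R]_6 -> 'rV[R]_6 -> 'rV[R]_6 -> R :=
  let x k := coframe g f (ix k) in
  wedge22 (wedge11 (x 1%N) (x 2%N)) (wedge11 (x 3%N) (x 4%N)).

Definition dot3 p q : R := p.1.1 * q.1.1 + p.1.2 * q.1.2 + p.2 * q.2.

(** The basis forms have square - 2 f^1234 and vanishing mutual products. *)
Lemma wedge22_asd f p q X Y Z W :
  wedge22 (asd g f p) (asd g f q) X Y Z W = - 2 * dot3 p q * vol4 f X Y Z W.
Proof. by rewrite /vol4 /dot3 /wedge22 /asd /wedge11; ring. Qed.

(** The contraction of a 2-form B with F is, up to the factor - 2, the trace of
    the bilinear form B(X, JY); so it can be computed in any unitary frame. *)
Lemma contraction_frame e f (B : 'rV[R]_6 -> 'rV[R]_6 -> R) :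
    unitary J g e -> unitary J g f ->
    (forall X, scalar (B X)) -> (forall X Y, B X Y = - B Y X) ->
  B (e (ix 1)) (e (ix 2)) + B (e (ix 3)) (e (ix 4)) + B (e (ix 5)) (e (ix 6))
  = B (f (ix 1)) (f (ix 2)) + B (f (ix 3)) (f (ix 4)) + B (f (ix 5)) (f (ix 6)).
Proof.
move=> eU fU Br BC.
have BN X Y : B X (- Y) = - B X Y.
  exact: scalar_opp.
have trace h : unitary J g h -> \sum_i B (h i) (J (h i)) = - 2 *
  (B (h (ix 1)) (h (ix 2)) + B (h (ix 3)) (h (ix 4)) + B (h (ix 5)) (h (ix 6))).
  move=> hU; have [J2 J4 J6] := unitaryJ hermJ hU; have [_ [J1 J3 J5]] := hU.
  rewrite sum6 J1 J2 J3 J4 J5 J6 !BN (BC (h (ix 2))) (BC (h (ix 4))).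
  by rewrite (BC (h (ix 6))); ring.
have BJl Y : scalar (fun X => B X (J Y)).
  by move=> a X X' /=; rewrite !(BC _ (J Y)) Br; ring.
have BJr X : scalar (fun Y => B X (J Y)) by move=> a Y Y' /=; rewrite linearP Br.
by have := bilinear_trace gP eU.1 fU.1 BJl BJr; rewrite !trace //; lra.
Qed.

Lemma contraction_asd e f r : unitary J g e -> unitary J g f ->
  asd g f r (e (ix 1)) (e (ix 2)) + asd g f r (e (ix 3)) (e (ix 4))
  + asd g f r (e (ix 5)) (e (ix 6)) = 0.
Proof.
move=> eU fU; have [fP _] := fU.
rewrite (contraction_frame eU fU (asd_scalarr f r) (asdC f r)).
by rewrite /asd /wedge11 /coframe !fP !eq_ix //=; ring.
Qed.

Lemma adapted_unitary e : adapted_frame J g e -> unitary J g e.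
Proof.
rewrite /adapted_frame /coframe /Jform => -[eP [c1 c3 c5] _]; split=> //.
by split; apply: (ip_inj gP) => Z; rewrite (ipC gP) (ipJ hermJ) (ipNr gP)
   (ipC gP Z) ?c1 ?c3 ?c5.
Qed.

End TwoForms.

(** * The Bismut connection of an abelian complex structure *)
Section Bismut.
Variables (R : realType) (L : nilpotent_lie_algebra R).
Variables (J : {linear 'rV[R]_6 -> 'rV[R]_6}) (g : 'rV[R]_6 -> 'rV[R]_6 -> R).
Hypothesis hermJ : hermitian_structure L J g.
Hypothesis abJ : abelian_complex_structure L J.
Implicit Types (X Y Z W : 'rV[R]_6) (e f : 'I_6 -> 'rV[R]_6) (p q r : R * R * R).

Let gP : inner_product g. Proof. by case: hermJ. Qed.

(** All the brackets in dF(JX, JY, JZ) are of the form [JX, JY] = [X, Y], and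
    F(U, JV) = - g(U, V). *)
Lemma torsionE X Y Z : torsion L J g X Y Z =
  - (g (br L X Y) Z + g (br L Y Z) X + g (br L Z X) Y).
Proof.
rewrite /torsion /d2 /fundF !abJ !(JJ hermJ) !(ipNr gP) (brC L Z X) (ipNl gP).
by ring.
Qed.

(** Half the torsion cancels two of Koszul's three terms and doubles the third. *)
Lemma bismutE e X i j : bismut L J g e X i j = g (br L (e i) (e j)) X.
Proof.
rewrite mxE torsionE /levi_civita (brC L (e i) (e j)) (ipNl gP) (brC L X).
by rewrite (ipNl gP); field.
Qed.

Section Curvature.
Variables (e f : 'I_6 -> 'rV[R]_6) (p q : R * R * R).
Hypothesis sf : structure_frame L J g f p q.
Let x k X := g (f (ix k)) X.
Let a i j := asd g f p (e i) (e j).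
Let b i j := asd g f q (e i) (e j).

Definition commutator i j : R := \sum_k (a i k * b k j - b i k * a k j).

Lemma ip_br X Y Z :
  g (br L X Y) Z = asd g f p X Y * x 5 Z + asd g f q X Y * x 6 Z.
Proof. by rewrite sf.2 (ipDl gP) !(ipZl gP). Qed.

Lemma br_frame X Y :
  g (br L X Y) (f (ix 5)) = asd g f p X Y /\
  g (br L X Y) (f (ix 6)) = asd g f q X Y.
Proof.
by rewrite !ip_br /x !(sf.1.1) !eq_ix //= !mulr1 !mulr0 addr0 add0r.
Qed.

(** The connection forms are a_ij f^5 + b_ij f^6, where df^5 = - alpha and
    df^6 = - beta; their products contribute only along f^5 /\ f^6. *)
Lemma curvature_bismut i j X Y : curvature L (bismut L J g e) i j X Y =
  - (a i j * asd g f p X Y + b i j * asd g f q X Y)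
  + commutator i j * wedge11 (x 5) (x 6) X Y.
Proof.
rewrite /curvature /d1 bismutE; congr (_ + _).
  by rewrite ip_br /x !(ipC gP (f _)) !(br_frame _ _).1 !(br_frame _ _).2.
rewrite mulr_suml; apply: eq_bigr => k _.
by rewrite /wedge11 !bismutE !ip_br -/(a _ _) -/(a _ _) -/(b _ _) -/(b _ _); ring.
Qed.

End Curvature.
End Bismut.

(** * SU(3)-connections and holonomy *)
Section SU3.
Variables (R : realType) (J : {linear 'rV[R]_6 -> 'rV[R]_6}).
Variables (g : 'rV[R]_6 -> 'rV[R]_6 -> R) (e : 'I_6 -> 'rV[R]_6).
Hypothesis gP : inner_product g.
Hypothesis eP : adapted_frame J g e.
Implicit Types (X Y Z W : 'rV[R]_6) (B : 'M[R]_6).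

Let eON : orthonormal g e. Proof. by case: eP. Qed.

Lemma coframe_endo B Y i : coframe g e i (endo g e B Y) =
  \sum_j B i j * coframe g e j Y.
Proof.
rewrite /coframe /endo (ip_sumr gP) (bigD1 i) //= [X in _ + X]big1 ?addr0.
  rewrite (ip_sumr gP); apply: eq_bigr => j _.
  by rewrite (ipZr gP) eON eqxx mulr1.
move=> k ki; rewrite (ip_sumr gP) big1 // => j _.
by rewrite (ipZr gP) eON eq_sym (negPf ki) mulr0.
Qed.

(** The Lie algebra su(3) in real coordinates: skew matrices, whose 2x2 blocks
    commute with J, and whose trace over C vanishes. *)
Definition su3_mx B :=
  let b k l := B (ix k) (ix l) in
  [/\ forall i j, B j i = - B i j,
      [/\ b 2%N 4%N = b 1%N 3%N, b 2%N 6%N = b 1%N 5%N & b 4%N 6%N = b 3%N 5%N],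
      [/\ b 2%N 3%N = - b 1%N 4%N, b 2%N 5%N = - b 1%N 6%N
        & b 4%N 5%N = - b 3%N 6%N] &
      b 1%N 2%N + b 3%N 4%N + b 5%N 6%N = 0].

(** The action of an element of su(3) with its dependent entries eliminated:
    with this, invariance of F and Psi becomes a polynomial identity. *)
Lemma coframe_su3 B Y : su3_mx B ->
  let c k := coframe g e (ix k) Y in let b k l := B (ix k) (ix l) in
  let d k := coframe g e (ix k) (endo g e B Y) in
  [/\ d 1%N = b 1%N 2%N * c 2%N + b 1%N 3%N * c 3%N + b 1%N 4%N * c 4%N
        + b 1%N 5%N * c 5%N + b 1%N 6%N * c 6%N,
      d 2%N = - b 1%N 2%N * c 1%N - b 1%N 4%N * c 3%N + b 1%N 3%N * c 4%N
        - b 1%N 6%N * c 5%N + b 1%N 5%N * c 6%N,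
      d 3%N = - b 1%N 3%N * c 1%N + b 1%N 4%N * c 2%N + b 3%N 4%N * c 4%N
        + b 3%N 5%N * c 5%N + b 3%N 6%N * c 6%N,
      d 4%N = - b 1%N 4%N * c 1%N - b 1%N 3%N * c 2%N - b 3%N 4%N * c 3%N
        - b 3%N 6%N * c 5%N + b 3%N 5%N * c 6%N &
      d 5%N = - b 1%N 5%N * c 1%N + b 1%N 6%N * c 2%N - b 3%N 5%N * c 3%N
        + b 3%N 6%N * c 4%N - (b 1%N 2%N + b 3%N 4%N) * c 6%N /\
      d 6%N = - b 1%N 6%N * c 1%N - b 1%N 5%N * c 2%N - b 3%N 6%N * c 3%N
        - b 3%N 5%N * c 4%N + (b 1%N 2%N + b 3%N 4%N) * c 5%N].
Proof.
move=> [skew [b24 b26 b46] [b23 b25 b45] tr] c b d.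
have diag i : B i i = 0 by have := skew i i; lra.
have b56 : b 5%N 6%N = - (b 1%N 2%N + b 3%N 4%N) by move: tr; rewrite /b; lra.
pose lower := (skew (ix 1) (ix 2), skew (ix 1) (ix 3), skew (ix 1) (ix 4),
  skew (ix 1) (ix 5), skew (ix 1) (ix 6), skew (ix 2) (ix 3), skew (ix 2) (ix
  4), skew (ix 2) (ix 5), skew (ix 2) (ix 6), skew (ix 3) (ix 4), skew (ix 3)
  (ix 5), skew (ix 3) (ix 6), skew (ix 4) (ix 5), skew (ix 4) (ix 6), skew (ix
  5) (ix 6)).
rewrite /d !coframe_endo !sum6 !diag !lower.
rewrite /b in b24 b26 b46 b23 b25 b45 b56.
by rewrite b24 b26 b46 b23 b25 b45 b56 /b /c; split; [..|split]; ring.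
Qed.

Lemma su3_mx_connection (s : 'rV[R]_6 -> 'M[R]_6) :
  (forall X, su3_mx (s X)) -> su3_connection J g e s.
Proof.
move=> su3; have [_ _ FE] := eP; split=> X.
  move=> Y Z; rewrite !FE /nabla /wedge11.
  have [-> -> -> -> [-> ->]] := coframe_su3 Y (su3 X).
  have [-> -> -> -> [-> ->]] := coframe_su3 Z (su3 X).
  by ring.
move=> Y Z W; rewrite /nabla /Psi /wedge21 /wedge11.
have [-> -> -> -> [-> ->]] := coframe_su3 Y (su3 X).
have [-> -> -> -> [-> ->]] := coframe_su3 Z (su3 X).
have [-> -> -> -> [-> ->]] := coframe_su3 W (su3 X).
apply/eqP; rewrite eq_complex; apply/andP; split; apply/eqP.
  by simpl; ring.
by simpl; ring.
Qed.

End SU3.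

Section Holonomy.
Variables (R : realType) (J : {linear 'rV[R]_6 -> 'rV[R]_6}).
Variables (g : 'rV[R]_6 -> 'rV[R]_6 -> R) (e : 'I_6 -> 'rV[R]_6).
Hypothesis gP : inner_product g.
Hypothesis eP : adapted_frame J g e.
Implicit Types (X Y Z W : 'rV[R]_6) (A B : 'M[R]_6) (u v w : R -> 'rV[R]_6).

Let eON : orthonormal g e. Proof. by case: eP. Qed.

Lemma eq_derive0 (f : R -> R) :
  (forall t : R, 0 <= t <= 1 -> is_derive t 1 f 0) -> f 1 = f 0.
Proof.
move=> df; have [| |t _] := @MVT R f (fun=> 0) 0 1 ltr01.
- by move=> t; rewrite in_itv /= => /andP[t0 t1]; apply: df; rewrite !ltW.
- apply: derivable_within_continuous => t; rewrite in_itv /= => t01.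
  by have := df t t01; case.
- by rewrite mul0r => /eqP; rewrite subr_eq0 => /eqP.
Qed.

(** Stated coordinate by coordinate, since parallel transport is given by the
    entries of its matrix. *)
Definition is_velocity u (t : R) (du : 'rV[R]_6) :=
  forall k, is_derive t 1 (fun t => coframe g e k (u t)) (coframe g e k du).

Lemma is_derive_sum6 (h : 'I_6 -> R -> R) (t : R) (dh : 'I_6 -> R) :
  (forall k, is_derive t 1 (h k) (dh k)) ->
  is_derive t 1 (fun t => \sum_k h k t) (\sum_k dh k).
Proof.
move=> H; have -> : (fun t => \sum_k h k t) = \sum_k h k.
  by apply/funext => x; rewrite fct_sumE.
exact: is_derive_sum.
Qed.

Lemma is_derive_mul (h k : R -> R) (t dh dk : R) :
  is_derive t 1 h dh -> is_derive t 1 k dk ->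
  is_derive t 1 (fun t => h t * k t) (dh * k t + h t * dk).
Proof.
move=> H K; apply: (is_derive_eq (is_deriveM H K)).
by rewrite addrC; congr (_ + _); rewrite mulrC.
Qed.

Lemma is_derive_cstl (h : R -> R) (c t dh : R) :
  is_derive t 1 h dh -> is_derive t 1 (fun t => h t * c) (dh * c).
Proof.
move=> H; have := is_derive_mul H (is_derive_cst c t 1).
by rewrite mulr0 addr0.
Qed.

Lemma is_derive_form1 (P : 'rV[R]_6 -> R) u (t : R) du : scalar P ->
  is_velocity u t du -> is_derive t 1 (fun t => P (u t)) (P du).
Proof.
move=> Pl H.
rewrite (_ : (fun _ => _) = fun t => \sum_k coframe g e k (u t) * P (e k)).
  rewrite (frame_scalar gP eON du Pl).
  by apply: is_derive_sum6 => k; apply: is_derive_cstl.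
by apply/funext => x; rewrite (frame_scalar gP eON (u x) Pl).
Qed.

Lemma is_derive_form2 (P : 'rV[R]_6 -> 'rV[R]_6 -> R) u v (t : R) du dv :
    (forall Y, scalar (P^~ Y)) -> (forall X, scalar (P X)) ->
    is_velocity u t du -> is_velocity v t dv ->
  is_derive t 1 (fun t => P (u t) (v t)) (P du (v t) + P (u t) dv).
Proof.
move=> Pl Pr H K.
rewrite (_ : (fun _ => _) =
    fun t => \sum_k coframe g e k (u t) * P (e k) (v t)).
  rewrite (frame_scalar gP eON du (Pl _)) (frame_scalar gP eON (u t) (Pl _)).
  rewrite -big_split; apply: is_derive_sum6 => k.
  by apply: is_derive_mul => //; apply: is_derive_form1.
by apply/funext => x; rewrite (frame_scalar gP eON (u x) (Pl _)).
Qed.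

Lemma is_derive_form3 (P : 'rV[R]_6 -> 'rV[R]_6 -> 'rV[R]_6 -> R)
    u v w (t : R) du dv dw :
    (forall Y Z, scalar (fun X => P X Y Z)) ->
    (forall X Z, scalar (fun Y => P X Y Z)) -> (forall X Y, scalar (P X Y)) ->
    is_velocity u t du -> is_velocity v t dv -> is_velocity w t dw ->
  is_derive t 1 (fun t => P (u t) (v t) (w t))
    (P du (v t) (w t) + P (u t) dv (w t) + P (u t) (v t) dw).
Proof.
move=> P1 P2 P3 Hu Hv Hw.
rewrite (_ : (fun _ => _) =
    fun t => \sum_k coframe g e k (u t) * P (e k) (v t) (w t)).
  rewrite (frame_scalar gP eON du (P1 _ _)) (frame_scalar gP eON (u t) (P1 _ _)).
  rewrite (frame_scalar gP eON (u t) (P1 _ _)) -!big_split.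
  apply: is_derive_sum6 => k /=; rewrite -addrA -mulrDr.
  by apply: is_derive_mul => //; apply: is_derive_form2.
by apply/funext => x; rewrite (frame_scalar gP eON (u x) (P1 _ _)).
Qed.

Lemma endo_mul A B X : endo g e (A *m B) X = endo g e A (endo g e B X).
Proof.
rewrite [RHS](frame_expand gP eON) [LHS](frame_expand gP eON).
apply: eq_bigr => i _; rewrite -/(coframe g e i _) -/(coframe g e i _).
rewrite !(coframe_endo gP eP); congr (_ *: _).
under [RHS]eq_bigr do rewrite (coframe_endo gP eP) mulr_sumr.
rewrite exchange_big; apply: eq_bigr => j _ /=.
by rewrite mxE mulr_suml; apply: eq_bigr => k _; rewrite mulrA.
Qed.

Lemma endo1 X : endo g e 1%:M X = X.
Proof.
rewrite [LHS](frame_expand gP eON) [RHS](frame_expand gP eON).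
apply: eq_bigr => i _; rewrite -/(coframe g e i _) (coframe_endo gP eP).
congr (_ *: _); rewrite (bigD1 i) //= mxE eqxx mul1r big1 ?addr0 // => j ji.
by rewrite mxE eq_sym (negPf ji) mul0r.
Qed.

Lemma endoN A X : endo g e (- A) X = - endo g e A X.
Proof.
rewrite /endo -sumrN; apply: eq_bigr => i _; rewrite -sumrN.
by apply: eq_bigr => j _; rewrite mxE mulNr scaleNr.
Qed.

Lemma velocity_endo (A : R -> 'M[R]_6) (t : R) B X :
  (forall i j, is_derive t 1 (fun t => A t i j) (B i j)) ->
  is_velocity (fun t => endo g e (A t) X) t (endo g e B X).
Proof.
move=> dA k; rewrite (coframe_endo gP eP).
rewrite (_ : (fun _ => _) = fun t => \sum_j A t k j * coframe g e j X).
  by apply: is_derive_sum6 => j; apply: is_derive_cstl.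
by apply/funext => x; rewrite (coframe_endo gP eP).
Qed.

End Holonomy.

Lemma complex_sum3_eq0 (R : realType) (a b c : complex R) : a + b + c = 0 ->
  complex.Re a + complex.Re b + complex.Re c = 0 /\
  complex.Im a + complex.Im b + complex.Im c = 0.
Proof. by case: a b c => [a a'] [b b'] [c c'] [-> ->]. Qed.

(** Along a curve, F(AX, AY) has the derivative
    - F(D(AX), AY) - F(AX, D(AY)), which vanishes because F is parallel, so its
    values at the two ends agree; likewise for the real and imaginary parts of
    Psi. *)
Lemma holonomy_su3 (R : realType) (M : nilmanifold R)
    (J : {linear 'rV[R]_6 -> 'rV[R]_6}) (g : 'rV[R]_6 -> 'rV[R]_6 -> R)
    (e : 'I_6 -> 'rV[R]_6) (s : 'rV[R]_6 -> 'M[R]_6) p B :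
    inner_product g -> adapted_frame J g e -> su3_connection J g e s ->
  holonomy M s p B -> SU3 J g e B.
Proof.
move=> gP eP [dF dP] [c [A [_ _ _ [A0 <-] dA]]].
have vel t X : 0 <= t <= 1 ->
    is_velocity g e (fun t => endo g e (A t) X) t
      (- nabla g e s (velocity M c t) (endo g e (A t) X)).
  move=> t01; rewrite /nabla -(endo_mul gP eP) -endoN.
  by apply: (velocity_endo gP eP) => i j; rewrite mxE; exact: dA.
pose b t X := endo g e (A t) X.
have b0 X : b 0 X = X by rewrite /b A0 (endo1 gP eP).
split=> [X Y|X Y Z]; rewrite -!/(b 1 _).
  rewrite -[in RHS](b0 X) -[in RHS](b0 Y).
  apply: (@eq_derive0 _ (fun t => fundF J g (b t X) (b t Y))) => t t01.
  apply: is_derive_eq.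
    apply: (is_derive_form2 gP eP) (vel _ _ t01) (vel _ _ t01).
    - by move=> ? a U V; rewrite /fundF /= !(ipC gP _ (J _)) (ip_scalar gP).
    - by move=> U a V W; rewrite /fundF linearP (ip_scalar gP).
  move: (dF (velocity M c t) (b t X) (b t Y)).
  by rewrite /fundF linearN (ipNl gP) (ipNr gP) -opprD => ->; rewrite oppr0.
have slots (pr : complex R -> R) : pr = @complex.Re R \/ pr = @complex.Im R ->
    [/\ forall V W, scalar (fun U => pr (Psi g e U V W)),
        forall U W, scalar (fun V => pr (Psi g e U V W)) &
        forall U V, scalar (fun W => pr (Psi g e U V W))].
  by case=> ->; split=> V W a U U'; rewrite /Psi /wedge21 /wedge11 /coframe
     !(ip_scalar gP) /=; ring.
have const (pr : complex R -> R) : pr = @complex.Re R \/ pr = @complex.Im R ->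
    pr (Psi g e (b 1 X) (b 1 Y) (b 1 Z)) = pr (Psi g e (b 0 X) (b 0 Y) (b 0 Z)).
  move=> prE; have [s1 s2 s3] := slots pr prE.
  apply: (@eq_derive0 _ (fun t => pr (Psi g e (b t X) (b t Y) (b t Z)))) => t t01.
  apply: is_derive_eq.
    exact: (is_derive_form3 gP eP s1 s2 s3) (vel _ _ t01) (vel _ _ t01) (vel _ _ t01).
  have := dP (velocity M c t) (b t X) (b t Y) (b t Z).
  move=> /complex_sum3_eq0[re im].
  rewrite (scalar_opp _ (s1 _ _)) (scalar_opp _ (s2 _ _)) (scalar_opp _ (s3 _ _)).
  by rewrite -!opprD; case: prE => ->; rewrite /b ?re ?im oppr0.
rewrite -[in RHS](b0 X) -[in RHS](b0 Y) -[in RHS](b0 Z).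
by apply/eqP; rewrite eq_complex; apply/andP; split; apply/eqP; apply: const;
   [left | right].
Qed.

(** * When the Bismut connection is an instanton *)
Section Instanton.
Variables (R : realType) (L : nilpotent_lie_algebra R).
Variables (J : {linear 'rV[R]_6 -> 'rV[R]_6}) (g : 'rV[R]_6 -> 'rV[R]_6 -> R).
Hypothesis hermJ : hermitian_structure L J g.
Hypothesis abJ : abelian_complex_structure L J.
Variables (e f : 'I_6 -> 'rV[R]_6) (p q : R * R * R).
Hypothesis eP : adapted_frame J g e.
Hypothesis sf : structure_frame L J g f p q.
Implicit Types (X Y Z W : 'rV[R]_6).

Let gP : inner_product g. Proof. by case: hermJ. Qed.
Let eU : unitary J g e. Proof. exact: (adapted_unitary hermJ eP). Qed.
Let eON : orthonormal g e. Proof. by case: eP. Qed.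

(** J-invariance of the bracket gives commutation with J, and primitivity of
    alpha and beta gives the trace. *)
Lemma bismut_su3_mx X : su3_mx (bismut L J g e X).
Proof.
have [J2 J4 J6] := unitaryJ hermJ eU; have [_ [J1 J3 J5]] := eU.
split.
- by move=> i j; rewrite !(bismutE hermJ abJ) brC (ipNl gP).
- by rewrite !(bismutE hermJ abJ) -!(abJ (e (ix 2))) -(abJ (e (ix 4))) J2 J4 J6.
- by rewrite !(bismutE hermJ abJ) -!(abJ (e (ix 2))) -(abJ (e (ix 4))) J2 J3 J4 J5
     !brNr !(ipNl gP).
- rewrite !(bismutE hermJ abJ) !(ip_br hermJ sf).
  have := contraction_asd hermJ p eU sf.1; have := contraction_asd hermJ q eU sf.1.
  set x := g _ X; set y := g _ X; move=> Hq Hp.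
  transitivity ((asd g f p (e (ix 1)) (e (ix 2)) + asd g f p (e (ix 3)) (e (ix 4))
    + asd g f p (e (ix 5)) (e (ix 6))) * x + (asd g f q (e (ix 1)) (e (ix 2))
    + asd g f q (e (ix 3)) (e (ix 4)) + asd g f q (e (ix 5)) (e (ix 6))) * y).
    by ring.
  by rewrite Hp Hq !mul0r addr0.
Qed.

Lemma bismut_su3_connection : su3_connection J g e (bismut L J g e).
Proof. by apply: (su3_mx_connection gP eP) => X; exact: bismut_su3_mx. Qed.

(** The contraction of the curvature with F is [a, b], as alpha and beta are
    primitive and f^5 /\ f^6 contracts to 1; the remaining part of the curvature
    is J-invariant. *)
Lemma instanton_commutator : su3_instanton L J g e (bismut L J g e) <->
  forall i j, commutator g e f p q i j = 0.
Proof.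
pose w := wedge11 (g (f (ix 5))) (g (f (ix 6))).
have wC X Y : w X Y = - w Y X by rewrite /w /wedge11; ring.
have wr X : scalar (w X).
  by move=> a Y Z; rewrite /w /wedge11 !(ip_scalar gP); ring.
have w_tr : w (e (ix 1)) (e (ix 2)) + w (e (ix 3)) (e (ix 4))
    + w (e (ix 5)) (e (ix 6)) = 1.
  rewrite (contraction_frame hermJ eU sf.1 wr wC) /w /wedge11 !(sf.1.1) !eq_ix //=.
  by ring.
have O i j := curvature_bismut hermJ abJ e sf i j.
have Hp := contraction_asd hermJ p eU sf.1.
have Hq := contraction_asd hermJ q eU sf.1.
split=> [[_ tr _] i j|K0].
  have := tr i j; rewrite !O -!/(w _ _).
  set K := commutator _ _ _ _ _ _ _.
  set a := asd g f p (e i) (e j); set b := asd g f q (e i) (e j) => E.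
  suff : K * 1 = 0 by rewrite mulr1.
  by rewrite -w_tr -E; move: Hp Hq; nra.
split; first exact: bismut_su3_connection.
- move=> i j; rewrite !O K0 !mul0r !addr0.
  set a := asd g f p (e i) (e j); set b := asd g f q (e i) (e j).
  by move: Hp Hq; nra.
- by move=> i j k l; rewrite !O K0 !mul0r !addr0 !(asdJ hermJ) //; case: sf.
Qed.

Lemma collinear_commutator :
  (forall X Y X' Y', asd g f p X Y * asd g f q X' Y'
                   = asd g f q X Y * asd g f p X' Y') ->
  forall i j, commutator g e f p q i j = 0.
Proof.
by move=> col i j; rewrite /commutator big1 // => k _; rewrite col subrr.
Qed.

Definition parallel3 (r s : R * R * R) :=
  [/\ r.1.1 * s.1.2 = r.1.2 * s.1.1, r.1.1 * s.2 = r.2 * s.1.1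
    & r.1.2 * s.2 = r.2 * s.1.2].

Lemma asd_frameE : orthonormal g f ->
  (forall r Y, asd g f r (f (ix 1)) Y =
    r.1.1 * g (f (ix 2)) Y + r.1.2 * g (f (ix 3)) Y + r.2 * g (f (ix 4)) Y) *
  (forall r Y, asd g f r (f (ix 2)) Y =
    - (r.1.1 * g (f (ix 1)) Y) + r.1.2 * g (f (ix 4)) Y - r.2 * g (f (ix 3)) Y) *
  (forall r Y, asd g f r (f (ix 3)) Y =
    - (r.1.1 * g (f (ix 4)) Y) - r.1.2 * g (f (ix 1)) Y + r.2 * g (f (ix 2)) Y) *
  (forall r Y, asd g f r (f (ix 4)) Y =
    r.1.1 * g (f (ix 3)) Y - r.1.2 * g (f (ix 2)) Y - r.2 * g (f (ix 1)) Y).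
Proof.
by move=> fP; do ![split] => r Y; rewrite /asd /wedge11 /coframe !fP !eq_ix //=; ring.
Qed.

(** Under su(2) = R^3 the commutator is twice the cross product.  The sum over k
    in it is a trace, and may be computed in the frame f, where alpha and beta
    are explicit; the entries (1,2), (1,3), (1,4) are the three components. *)
Lemma commutator_parallel :
  (forall i j, commutator g e f p q i j = 0) -> parallel3 p q.
Proof.
move=> K0; have fP := sf.1.1.
pose B X Y U V := asd g f p X U * asd g f q V Y - asd g f q X U * asd g f p V Y.
have Bl X Y V : scalar (B X Y ^~ V).
  by move=> a U U'; rewrite /B !(asd_scalarr hermJ); ring.
have Br X Y U : scalar (B X Y U).
  by move=> a V V'; rewrite /B !(asd_scalarl hermJ f _ Y); ring.
have K X Y : \sum_k B X Y (f k) (f k) = 0.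
  rewrite (bilinear_trace gP eON fP (Bl X Y) (Br X Y)).
  pose C X Y := \sum_k B X Y (e k) (e k).
  apply: (frame_bilinear_eq0 gP eON (B := C)) => [V|U|i j].
  - move=> a U U'; rewrite /C mulr_sumr -big_split; apply: eq_bigr => k _.
    by rewrite /B /= !(asd_scalarl hermJ f _ (e k)); ring.
  - move=> a V V'; rewrite /C mulr_sumr -big_split; apply: eq_bigr => k _.
    by rewrite /B /= !(asd_scalarr hermJ); ring.
  - exact: K0.
have E Y : \sum_k B (f (ix 1)) Y (f k) (f k) =
    p.1.1 * asd g f q (f (ix 2)) Y + p.1.2 * asd g f q (f (ix 3)) Y
    + p.2 * asd g f q (f (ix 4)) Y - (q.1.1 * asd g f p (f (ix 2)) Y
    + q.1.2 * asd g f p (f (ix 3)) Y + q.2 * asd g f p (f (ix 4)) Y).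
  rewrite sum6 /B !(asd_frameE fP).1.1.1 !fP !eq_ix //=.
  rewrite !(mulr0, mulr1, mul0r, addr0, add0r, subr0).
  by ring.
have {}K Y := etrans (esym (E Y)) (K _ Y).
have := (K (f (ix 2)), K (f (ix 3)), K (f (ix 4))) => {K E}.
rewrite !(asd_frameE fP) !fP !eq_ix //= !(mulr0, mulr1, mul0r, addr0, add0r, subr0).
rewrite ?(oppr0, addr0, add0r, sub0r) => -[[E2 E3] E4].
have half (u v : R) : 2 * (u - v) = 0 -> u = v.
  by move/eqP; rewrite mulf_eq0 pnatr_eq0 subr_eq0 => /eqP.
split.
by apply: half; rewrite -[RHS]E4; ring.
by apply/esym/half; rewrite -[RHS]E3; ring.
by apply: half; rewrite -[RHS]E2; ring.
Qed.

End Instanton.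

(** * Anomaly cancellation *)

Lemma exists_linear (R : nzRingType) (U V : lmodType R) (h : U -> V) :
  linear h -> exists F : {linear U -> V}, GRing.Linear.sort F = h.
Proof.
move=> hlin; pose H := GRing.isLinear.Build R U V *:%R h hlin.
pose F : {linear U -> V} := HB.pack h H.
by exists F.
Qed.

Lemma upper_sum (R : realType) (h : 'I_6 -> 'I_6 -> R) :
    (forall i j, h i j = h j i) -> (forall i, h i i = 0) ->
  \sum_i \sum_j h i j = 2 * \sum_(i < 6) \sum_(j < 6 | (i < j)%N) h i j.
Proof.
move=> hC h0; pose u (i j : 'I_6) := if (i < j)%N then h i j else 0.
have -> : \sum_(i < 6) \sum_(j < 6 | (i < j)%N) h i j = \sum_i \sum_j u i j.
  by apply: eq_bigr => i _; rewrite big_mkcond.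
have -> : \sum_i \sum_j h i j = \sum_i \sum_j u i j + \sum_i \sum_j u j i.
  rewrite -big_split; apply: eq_bigr => i _; rewrite -big_split.
  apply: eq_bigr => j _; rewrite /= /u.
  by case: ltngtP => [| |/val_inj ->]; rewrite ?h0 ?addr0 ?add0r.
by rewrite [X in _ + X]exchange_big mulrDl mul1r.
Qed.

Section Anomaly.
Variables (R : realType) (L : nilpotent_lie_algebra R).
Variables (J : {linear 'rV[R]_6 -> 'rV[R]_6}) (g : 'rV[R]_6 -> 'rV[R]_6 -> R).
Hypothesis hermJ : hermitian_structure L J g.
Hypothesis abJ : abelian_complex_structure L J.
Variables (e f : 'I_6 -> 'rV[R]_6) (p q : R * R * R).
Hypothesis eP : adapted_frame J g e.
Hypothesis sf : structure_frame L J g f p q.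
Implicit Types (X Y Z W : 'rV[R]_6).

Let gP : inner_product g. Proof. by case: hermJ. Qed.
Let eU : unitary J g e. Proof. exact: (adapted_unitary hermJ eP). Qed.
Let eON : orthonormal g e. Proof. by case: eP. Qed.
Let fP : orthonormal g f. Proof. by case: sf => -[]. Qed.

Lemma br_2step X Y Z : br L (br L X Y) Z = 0.
Proof.
rewrite [br L X Y]sf.2 brDl !brZl.
have c5 : br L (f (ix 5)) Z = 0.
  rewrite sf.2 /asd /wedge11 /coframe !fP !eq_ix //=.
  by rewrite !(mul0r, mulr0, subr0, addr0, scale0r).
have c6 : br L (f (ix 6)) Z = 0.
  rewrite sf.2 /asd /wedge11 /coframe !fP !eq_ix //=.
  by rewrite !(mul0r, mulr0, subr0, addr0, scale0r).
by rewrite c5 c6 !scaler0 addr0.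
Qed.

Lemma ip_br_br X Y Z W : g (br L X Y) (br L Z W) =
  asd g f p X Y * asd g f p Z W + asd g f q X Y * asd g f q Z W.
Proof.
rewrite (ip_br hermJ sf) !(ipC gP (f _)).
by rewrite (br_frame hermJ sf _ _).1 (br_frame hermJ sf _ _).2.
Qed.

(** Brackets are central, so that dT is the alternating sum of the terms
    2 g([X, Y], [Z, W]), which is alpha /\ alpha + beta /\ beta. *)
Lemma d3_torsion X Y Z W : d3 L (torsion L J g) X Y Z W =
  - 2 * (dot3 p p + dot3 q q) * vol4 g f X Y Z W.
Proof.
rewrite /d3 !(torsionE hermJ abJ) !br_2step.
rewrite !(brC L _ (br L _ _)) !br_2step !oppr0 !(ip0l gP) !ip_br_br.
have -> : - 2 * (dot3 p p + dot3 q q) * vol4 g f X Y Z W =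
  wedge22 (asd g f p) (asd g f p) X Y Z W + wedge22 (asd g f q) (asd g f q) X Y Z W.
  by rewrite !wedge22_asd; ring.
by rewrite /wedge22; ring.
Qed.

Definition lin3 (a : R) (r : R * R * R) (b : R) (s : R * R * R) : R * R * R :=
  (a * r.1.1 + b * s.1.1, a * r.1.2 + b * s.1.2, a * r.2 + b * s.2).

Lemma asd_lin3 a b X Y :
  asd g f (lin3 a p b q) X Y = a * asd g f p X Y + b * asd g f q X Y.
Proof. by rewrite /asd /=; ring. Qed.

Lemma asd0 X Y : asd g f (0, 0, 0) X Y = 0.
Proof. by rewrite /asd /=; ring. Qed.

Lemma dot3_ge0 (r : R * R * R) : 0 <= dot3 r r.
Proof. by rewrite /dot3 -!expr2 !addr_ge0 ?sqr_ge0. Qed.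

Lemma dot3_eq0 (r : R * R * R) : dot3 r r = 0 -> r = (0, 0, 0).
Proof.
case: r => [[r1 r2] r3]; rewrite /dot3 /= -!expr2 => /eqP.
rewrite !paddr_eq0 ?addr_ge0 ?sqr_ge0 // !sqrf_eq0.
by case/andP=> /andP[/eqP-> /eqP->] /eqP->.
Qed.

Let a i j := asd g f p (e i) (e j).
Let b i j := asd g f q (e i) (e j).
Let K i j := commutator g e f p q i j.

(** These are the traces of [a, b] a and [a, b] b, up to sign. *)
Lemma sum_commutator :
  \sum_i \sum_j K i j * a i j = 0 /\ \sum_i \sum_j K i j * b i j = 0.
Proof.
pose A := \matrix_(i, j) a i j; pose B := \matrix_(i, j) b i j.
have KE i j : K i j = (A *m B - B *m A) i j.
  rewrite !mxE -sumrB; apply: eq_bigr => k _; rewrite !mxE.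
  by rewrite -/(a _ _) -/(b _ _) -/(a _ _) -/(b _ _).
have tr (C : 'M[R]_6) (c : 'I_6 -> 'I_6 -> R) :
    (forall i j, c i j = - C j i) ->
    \sum_i \sum_j K i j * c i j = - \tr ((A *m B - B *m A) *m C).
  move=> cC; rewrite /mxtrace -sumrN; apply: eq_bigr => i _.
  rewrite [X in - X]mxE -sumrN; apply: eq_bigr => j _.
  by rewrite KE cC mulrN.
split.
  rewrite (tr A) => [|i j]; last by rewrite mxE /a asdC.
  by rewrite mulmxBl linearB /= (mxtrace_mulC (B *m A)) mulmxA subrr oppr0.
rewrite (tr B) => [|i j]; last by rewrite mxE /b asdC.
by rewrite mulmxBl linearB /= (mxtrace_mulC (A *m B)) mulmxA subrr oppr0.
Qed.

Let S := \sum_(i < 6) \sum_(j < 6 | (i < j)%N)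
  dot3 (lin3 (a i j) p (b i j) q) (lin3 (a i j) p (b i j) q).

(** Squaring the curvature, the terms with f^5 /\ f^6 have the coefficients
    [a, b]_ij a_ij and [a, b]_ij b_ij, whose sums vanish; what remains is the sum
    of the squares of the anti-self-dual forms a_ij alpha + b_ij beta. *)
Lemma p1_bismut X Y Z W : p1 L (bismut L J g e) X Y Z W =
  (8 * pi ^+ 2)^-1 * (- 2 * S * vol4 g f X Y Z W).
Proof.
rewrite /p1; congr (_ * _).
pose w := wedge11 (g (f (ix 5))) (g (f (ix 6))).
pose N r := 2 * wedge22 (asd g f r) w X Y Z W.
have term i j : wedge22 (curvature L (bismut L J g e) i j)
    (curvature L (bismut L J g e) i j) X Y Z W =
  - 2 * vol4 g f X Y Z W
      * dot3 (lin3 (a i j) p (b i j) q) (lin3 (a i j) p (b i j) q)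
  - (K i j * a i j * N p + K i j * b i j * N q).
  transitivity (wedge22 (asd g f (lin3 (a i j) p (b i j) q))
      (asd g f (lin3 (a i j) p (b i j) q)) X Y Z W
    - (K i j * a i j * N p + K i j * b i j * N q)
    + K i j ^+ 2 * wedge22 w w X Y Z W).
    rewrite /N /wedge22 !(curvature_bismut hermJ abJ e sf) !asd_lin3.
    rewrite -/(a _ _) -/(b _ _) -/(K _ _) -!/(w _ _).
    by ring.
  rewrite wedge22_asd; have -> : wedge22 w w X Y Z W = 0.
    by rewrite /w /wedge22 /wedge11; ring.
  by ring.
have half (h : 'I_6 -> 'I_6 -> R) : (forall i j, h i j = h j i) ->
    (forall i, h i i = 0) -> \sum_i \sum_j h i j = 0 ->
    \sum_(i < 6) \sum_(j < 6 | (i < j)%N) h i j = 0.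
  move=> hC h0; rewrite upper_sum // => /eqP.
  by rewrite mulf_eq0 pnatr_eq0 => /eqP.
have aC i j : a i j = - a j i by rewrite /a asdC.
have bC i j : b i j = - b j i by rewrite /b asdC.
have a0 i : a i i = 0 by have := aC i i; lra.
have b0 i : b i i = 0 by have := bC i i; lra.
have KC i j : K i j = - K j i.
  rewrite /K /commutator -sumrN; apply: eq_bigr => k _.
  rewrite -!/(a _ _) -!/(b _ _) (aC i k) (aC k j) (bC i k) (bC k j); ring.
have [Ka Kb] := sum_commutator.
have Ka0 : \sum_(i < 6) \sum_(j < 6 | (i < j)%N) K i j * a i j = 0.
  by apply: half => // [i j|i]; rewrite ?a0 ?mulr0 // KC aC mulrNN.
have Kb0 : \sum_(i < 6) \sum_(j < 6 | (i < j)%N) K i j * b i j = 0.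
  by apply: half => // [i j|i]; rewrite ?b0 ?mulr0 // KC bC mulrNN.
transitivity (- 2 * vol4 g f X Y Z W * S
  - ((\sum_(i < 6) \sum_(j < 6 | (i < j)%N) K i j * a i j) * N p
  + (\sum_(i < 6) \sum_(j < 6 | (i < j)%N) K i j * b i j) * N q)); last first.
  by rewrite Ka0 Kb0 !mul0r; ring.
rewrite /S mulr_sumr !mulr_suml -big_split -sumrB /=; apply: eq_bigr => i _.
rewrite mulr_sumr !mulr_suml -big_split -sumrB /=; apply: eq_bigr => j _.
exact: term.
Qed.

(** If every a_ij p + b_ij q vanished, so would alpha(X, Y) p + beta(X, Y) q for
    all X and Y; on (f_1, f_2), (f_1, f_3), (f_1, f_4) its respective coordinates
    add up to |p|^2 + |q|^2. *)
Lemma sum_dot3_gt0 : 0 < dot3 p p + dot3 q q -> 0 < S.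
Proof.
move=> D0; have S0 : 0 <= S.
  by apply: sumr_ge0 => i _; apply: sumr_ge0 => j _; exact: dot3_ge0.
rewrite lt0r S0 andbT; apply/eqP => SE.
pose h i j := dot3 (lin3 (a i j) p (b i j) q) (lin3 (a i j) p (b i j) q).
have hC i j : h i j = h j i.
  by rewrite /h /a /b (asdC _ _ _ (e i)) (asdC _ _ _ (e i)) /dot3 /=; ring.
have h0 i : h i i = 0.
  have := asdC g f p (e i) (e i); have := asdC g f q (e i) (e i).
  rewrite -/(a _ _) -/(b _ _) => b0 a0.
  have {}a0 : a i i = 0 by lra.
  have {}b0 : b i i = 0 by lra.
  by rewrite /h a0 b0 /dot3 /=; ring.
have hz i j : lin3 (a i j) p (b i j) q = (0, 0, 0).
  apply: dot3_eq0.
  have sum0 := upper_sum hC h0; rewrite [X in 2 * X]SE mulr0 in sum0.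
  have sum0i : \sum_j h i j = 0.
    apply: (psumr_eq0P _ sum0) => // k _.
    by apply: sumr_ge0 => l _; exact: dot3_ge0.
  by apply: (psumr_eq0P _ sum0i) => // k _; exact: dot3_ge0.
pose B (c d : R) X Y := c * asd g f p X Y + d * asd g f q X Y.
have B0 c d : (forall i j, B c d (e i) (e j) = 0) -> forall X Y, B c d X Y = 0.
  apply: (frame_bilinear_eq0 gP eON) => [Y|X] k U V.
    by rewrite /B !(asd_scalarl hermJ); ring.
  by rewrite /B !(asd_scalarr hermJ); ring.
have B1 X Y : B p.1.1 q.1.1 X Y = 0.
  by apply: B0 => i j; case: (hz i j) => E _ _; rewrite -[RHS]E /B /a /b; ring.
have B2 X Y : B p.1.2 q.1.2 X Y = 0.
  by apply: B0 => i j; case: (hz i j) => _ E _; rewrite -[RHS]E /B /a /b; ring.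
have B3 X Y : B p.2 q.2 X Y = 0.
  by apply: B0 => i j; case: (hz i j) => _ _ E; rewrite -[RHS]E /B /a /b; ring.
suff : dot3 p p + dot3 q q = 0 by lra.
transitivity (B p.1.1 q.1.1 (f (ix 1)) (f (ix 2))
  + B p.1.2 q.1.2 (f (ix 1)) (f (ix 3)) + B p.2 q.2 (f (ix 1)) (f (ix 4))).
  by rewrite /B !(asd_frameE fP) !fP !eq_ix //= /dot3; ring.
by rewrite B1 B2 B3 !addr0.
Qed.

(** The anti-self-dual form with coordinates m is g([X, Y], [., .]), whose value
    at (X, Y) is positive. *)
Lemma dot3_lin3_gt0 X Y :
  br L X Y != 0 ->
  0 < dot3 p p + dot3 q q /\
  let m := lin3 (asd g f p X Y) p (asd g f q X Y) q in 0 < dot3 m m.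
Proof.
move=> br0; have := ip_gt0 gP br0; rewrite ip_br_br => pos; split.
  rewrite lt0r addr_ge0 ?dot3_ge0 // andbT; apply/eqP => /eqP.
  rewrite paddr_eq0 ?dot3_ge0 // => /andP[/eqP/dot3_eq0 pE /eqP/dot3_eq0 qE].
  by move: pos; rewrite pE qE !asd0 mulr0 addr0 ltxx.
move=> m; rewrite lt0r dot3_ge0 andbT; apply/eqP => /dot3_eq0 mE.
by move: pos; rewrite -asd_lin3 -/m mE asd0 ltxx.
Qed.

(** Up to sign the complex matrix diag(i, - i, 0). *)
Definition su3_gen : 'M[R]_6 := \matrix_(i, j)
  (((i == ix 1) && (j == ix 2))%:R - ((i == ix 2) && (j == ix 1))%:R
   - ((i == ix 3) && (j == ix 4))%:R + ((i == ix 4) && (j == ix 3))%:R).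

Lemma su3_gen_skew i j : su3_gen j i = - su3_gen i j.
Proof. by rewrite !mxE ![(i == _) && _]andbC; ring. Qed.

Lemma su3_genP c : su3_mx (c *: su3_gen).
Proof.
split; last 3 first.
- by rewrite !mxE !eq_ix.
- by rewrite !mxE !eq_ix //= ; split; ring.
- by rewrite !mxE !eq_ix //= ; ring.
- by move=> i j; rewrite mxE [in RHS]mxE su3_gen_skew mulrN.
Qed.

Lemma sum_su3_gen : \sum_(i < 6) \sum_(j < 6 | (i < j)%N) su3_gen i j ^+ 2 = 2.
Proof.
apply: (mulfI (_ : 2 != 0)); first by rewrite pnatr_eq0.
rewrite -upper_sum => [|i j|i].
- by rewrite !sum6 !mxE !eq_ix //=; ring.
- by rewrite su3_gen_skew sqrrN.
- have E := su3_gen_skew i i.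
  by have -> : su3_gen i i = 0; [lra | rewrite expr0n].
Qed.

(** The quadratic part of the curvature vanishes, since only one matrix
    occurs. *)
Definition abelian_connection (c : R) V X : 'M[R]_6 := (c * g V X) *: su3_gen.

Lemma abelian_connection_linear c V : linear (abelian_connection c V).
Proof.
move=> k X Y; rewrite /abelian_connection (ip_scalar gP) scalerA -scalerDl.
by congr (_ *: _); ring.
Qed.

Lemma curvature_abelian c V i j X Y :
  curvature L (abelian_connection c V) i j X Y = - (c * g V (br L X Y)) * su3_gen i j.
Proof.
rewrite /curvature /d1 /wedge11 /abelian_connection big1 ?addr0.
  by rewrite [in LHS]mxE mulNr.
by move=> k _; rewrite ![(_ *: su3_gen) _ _]mxE; ring.
Qed.

(** The curvature is a multiple of g(V, [X, Y]), a combination of alpha and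
    beta. *)
Lemma abelian_instanton c V : su3_instanton L J g e (abelian_connection c V).
Proof.
have Hp := contraction_asd hermJ p eU sf.1.
have Hq := contraction_asd hermJ q eU sf.1.
have trace : g V (br L (e (ix 1)) (e (ix 2))) + g V (br L (e (ix 3)) (e (ix 4)))
    + g V (br L (e (ix 5)) (e (ix 6))) = 0.
  rewrite ![g V _](ipC gP) !(ip_br hermJ sf).
  set x := g _ V; set y := g _ V.
  transitivity (x * (asd g f p (e (ix 1)) (e (ix 2)) + asd g f p (e (ix 3)) (e (ix 4))
    + asd g f p (e (ix 5)) (e (ix 6))) + y * (asd g f q (e (ix 1)) (e (ix 2))
    + asd g f q (e (ix 3)) (e (ix 4)) + asd g f q (e (ix 5)) (e (ix 6)))).
    by ring.
  by rewrite Hp Hq !mulr0 addr0.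
split.
- by apply: (su3_mx_connection gP eP) => X; exact: su3_genP.
- move=> i j; rewrite !curvature_abelian -!mulrDl -!opprD -!mulrDr trace.
  by rewrite mulr0 oppr0 mul0r.
- by move=> i j k l; rewrite !curvature_abelian abJ.
Qed.

Lemma p1_abelian c V X Y Z W (m := lin3 (g V (f (ix 5))) p (g V (f (ix 6))) q) :
  p1 L (abelian_connection c V) X Y Z W =
  (8 * pi ^+ 2)^-1 * (- 4 * c ^+ 2 * dot3 m m * vol4 g f X Y Z W).
Proof.
rewrite /p1; congr (_ * _).
transitivity (c ^+ 2 * wedge22 (asd g f m) (asd g f m) X Y Z W
  * \sum_(i < 6) \sum_(j < 6 | (i < j)%N) su3_gen i j ^+ 2).
  rewrite mulr_sumr; apply: eq_bigr => i _; rewrite mulr_sumr; apply: eq_bigr => j _.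
  rewrite /wedge22 !curvature_abelian.
  have E U U' : g V (br L U U') = asd g f m U U'.
    by rewrite asd_lin3 (ipC gP) (ip_br hermJ sf) !(ipC gP (f _)); ring.
  by rewrite !E; ring.
by rewrite sum_su3_gen wedge22_asd; ring.
Qed.

(** Relative to the volume form of the span of f_1, ..., f_4, dT is
    - 2 (|p|^2 + |q|^2) and 8 pi^2 (p_1(nabla) - p_1(A)) is
    - 2 (S - 2 c^2 |m|^2), so every small enough c gives a positive constant.
    The vector V is a nonzero bracket, which makes A non-flat. *)
Lemma exists_anomaly_free X0 Y0 : br L X0 Y0 != 0 ->
  exists A : {linear 'rV[R]_6 -> 'M[R]_6},
    [/\ su3_instanton L J g e A, ~ flat L A &
        anomaly_cancellation L J g (bismut L J g e) A].
Proof.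
move=> br0; set V := br L X0 Y0.
have [D0 m0] := dot3_lin3_gt0 br0; have S0 := sum_dot3_gt0 D0.
move: D0 m0; rewrite -(br_frame hermJ sf X0 Y0).1 -(br_frame hermJ sf X0 Y0).2.
rewrite -/V /=; set D := _ + _; set m := lin3 _ _ _ _ => D0 m0.
(* This scale makes S - 2 c^2 |m|^2 equal to S / 2. *)
pose c := Num.sqrt (S / (4 * dot3 m m)).
have cE : c ^+ 2 = S / (4 * dot3 m m).
  by rewrite sqr_sqrtr // ltW // divr_gt0 // mulr_gt0.
have [A AE] := exists_linear (abelian_connection_linear c V).
exists A; rewrite AE; split.
- exact: abelian_instanton.
- move=> /(_ (ix 1) (ix 2) X0 Y0) /eqP; apply/negP.
  rewrite curvature_abelian mulf_neq0 // ?oppr_eq0.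
    rewrite mulf_neq0 // ?gt_eqF ?ip_gt0 //.
    by rewrite sqrtr_gt0 divr_gt0 // mulr_gt0.
  by rewrite !mxE !eq_ix //= subr0 addr0 subr0 oner_eq0.
exists (8 * D / S) => [|X Y Z W]; first by rewrite divr_gt0 // mulr_gt0.
rewrite d3_torsion p1_bismut p1_abelian -/m -/D cE.
have pi0 : pi != 0 :> R by rewrite gt_eqF // pi_gt0.
have Sn0 : S != 0 by rewrite gt_eqF.
have mn0 : dot3 m m != 0 by rewrite gt_eqF.
have fieldE (P SS DD mm v : R) : P != 0 -> SS != 0 -> mm != 0 ->
    - 2 * DD * v = 2 * P ^+ 2 * (8 * DD / SS) * ((8 * P ^+ 2)^-1 * (- 2 * SS * v)
      - (8 * P ^+ 2)^-1 * (- 4 * (SS / (4 * mm)) * mm * v)).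
  by move=> P0 SS0 mm0; field; rewrite P0 SS0 mm0.
exact: fieldE.
Qed.

End Anomaly.

(** * Isomorphisms of 2-step groups in exponential coordinates *)

Local Open Scope classical_set_scope.
Local Open Scope ring_scope.

Section LieGroups.
Variables (R : realType).
Implicit Types (L : nilpotent_lie_algebra R) (X Y : 'rV[R]_6).

Lemma gmul_2step L X Y : (forall U V W, br L U (br L V W) = 0) ->
  gmul L X Y = X + Y + 2^-1 *: br L X Y.
Proof.
move=> H; rewrite /gmul !H ?br0r.
by rewrite !(addr0, scaler0, subr0).
Qed.

Lemma linear_differentiable6 (F : {linear 'rV[R]_6 -> 'rV[R]_6}) X :
  differentiable F X.
Proof.
have -> : (F : 'rV[R]_6 -> 'rV[R]_6) =
    \sum_(j < 6) (fun Y => Y 0 j *: F (delta_mx 0 j)).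
  apply/funext => Y; rewrite {1}[Y]row_sum_delta linear_sum fct_sumE.
  by apply: eq_bigr => j _; rewrite linearZ.
apply: differentiable_sum => j; apply: differentiableZl.
exact: differentiable_coord.
Qed.

Lemma linear_inverse (F : {linear 'rV[R]_6 -> 'rV[R]_6}) :
  (forall X, F X = 0 -> X = 0) ->
  exists G : {linear 'rV[R]_6 -> 'rV[R]_6}, cancel F G /\ cancel G F.
Proof.
move=> Finj; have P1 : lin1_mx F \in unitmx.
  rewrite -row_free_unit -kermx_eq0; apply/rowV0P => v /sub_kermxP.
  by rewrite mul_rV_lin1; exact: Finj.
exists (mulmxr (invmx (lin1_mx F))).
by split=> X /=; rewrite -!mul_rV_lin1 ?mulmxK ?mulmxKV.
Qed.

(** The group product is built from sums, multiples and brackets, and linear maps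
    of R^6 are differentiable. *)
Lemma linear_lie_group_isomorphic L L' (F : {linear 'rV[R]_6 -> 'rV[R]_6}) :
    (forall X, F X = 0 -> X = 0) ->
    (forall X Y, F (br L X Y) = br L' (F X) (F Y)) ->
  lie_group_isomorphic L L'.
Proof.
move=> /linear_inverse[G FG] Fbr; exists F, G; split=> // [X|X|X Y].
- exact: linear_differentiable6.
- exact: linear_differentiable6.
- have FD U V : F (U + V) = F U + F V := linearD F U V.
  have FN U : F (- U) = - F U := linearN F U.
  have FZ c U : F (c *: U) = c *: F U by exact: linearZ.
  by rewrite /gmul !(FD, FN, FZ, Fbr).
Qed.

(** A homomorphism commutes with integer multiples, which are powers in
    exponential coordinates, so it agrees with its differential at 0: its
    difference quotients along 1/n are constant. *)
Lemma lie_group_hom_linear L L' (phi : 'rV[R]_6 -> 'rV[R]_6) :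
    (forall U V W, br L U (br L V W) = 0) ->
    (forall U V W, br L' U (br L' V W) = 0) ->
    differentiable phi 0 ->
    (forall X Y, phi (gmul L X Y) = gmul L' (phi X) (phi Y)) ->
  forall X, phi X = 'd phi 0 X.
Proof.
move=> st st' dphi hom X.
have hom2 U V : br L U V = 0 -> br L' (phi U) (phi V) = 0 ->
    phi (U + V) = phi U + phi V.
  move=> b0 b0'; have := hom U V; rewrite !gmul_2step // b0 b0'.
  by rewrite !scaler0 !addr0.
have phi0 : phi 0 = 0.
  have := hom2 0 0; rewrite br0l br_alternating addr0.
  move=> /(_ erefl erefl) /eqP.
  by rewrite -subr_eq0 opprD addrA subrr add0r oppr_eq0 => /eqP.
have phiM n U : phi (n%:R *: U) = n%:R *: phi U.
  elim: n => [|n IH]; first by rewrite !scale0r phi0.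
  have b0 L1 V : br L1 (n%:R *: V) V = 0 by rewrite brZl br_alternating scaler0.
  rewrite -natr1 !scalerDl !scale1r hom2 ?b0 //; first by rewrite IH.
  by rewrite IH b0.
have phi_inv n : n.+1%:R *: phi (n.+1%:R^-1 *: X) = phi X.
  by rewrite -phiM scalerA mulfV ?scale1r // pnatr_eq0.
have lim : (fun h : R => h^-1 *: (phi (h *: X + 0) - phi 0)) @ 0^' --> 'd phi 0 X.
  by rewrite -deriveE //; exact: diff_derivable.
have harm : @harmonic R @ \oo --> 0^'.
  move=> A A0.
  have : \forall n \near \oo, @harmonic R n != 0 -> A (harmonic n).
    exact: (@cvg_harmonic R _ A0).
  by apply: filterS => n; apply; rewrite invr_eq0 pnatr_eq0.
have := cvg_comp _ _ harm lim.
rewrite [X in X @ _ --> _](_ : _ = cst (phi X)); last first.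
  by apply/funext => n /=; rewrite addr0 phi0 subr0 invrK phi_inv.
move=> lim_phi; have lim_cst : cst (phi X) @ \oo --> phi X by exact: cvg_cst.
exact: (cvg_unique (@norm_hausdorff _ _) lim_cst lim_phi).
Qed.

(** An isomorphism of 2-step groups is linear, and comparing the quadratic
    terms of the two products shows that it respects brackets. *)
Lemma lie_group_isomorphic_linear L L' :
    (forall U V W, br L U (br L V W) = 0) ->
    (forall U V W, br L' U (br L' V W) = 0) ->
    lie_group_isomorphic L L' ->
  exists F : {linear 'rV[R]_6 -> 'rV[R]_6},
    injective F /\ forall X Y, F (br L X Y) = br L' (F X) (F Y).
Proof.
move=> st st' [phi [psi [[phiK _] dphi _ hom]]].
have phiE := lie_group_hom_linear st st' (dphi 0) hom.
exists ('d phi 0); split=> [X Y|X Y]; first by rewrite -!phiE => /(can_inj phiK).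
have := hom X Y; rewrite !gmul_2step // !phiE.
have FD U V : 'd phi 0 (U + V) = 'd phi 0 U + 'd phi 0 V by exact: linearD.
have FZ c U : 'd phi 0 (c *: U) = c *: 'd phi 0 U by exact: linearZ.
rewrite !FD FZ => /addrI /(scalerI _); apply.
by rewrite invr_eq0 pnatr_eq0.
Qed.

Definition h3_coord (x1 x2 x3 x4 x5 x6 : 'rV[R]_6 -> R) X : 'rV[R]_6 :=
  x1 X *: delta_mx 0 (ix 1) + x2 X *: delta_mx 0 (ix 2)
  + x3 X *: delta_mx 0 (ix 3) + x4 X *: delta_mx 0 (ix 4)
  + x5 X *: delta_mx 0 (ix 5) + x6 X *: delta_mx 0 (ix 6).

Lemma h3_coordE (x1 x2 x3 x4 x5 x6 : 'rV[R]_6 -> R) X :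
  let F := h3_coord x1 x2 x3 x4 x5 x6 X in
  (F 0 (ix 1) = x1 X) * (F 0 (ix 2) = x2 X) * (F 0 (ix 3) = x3 X)
  * (F 0 (ix 4) = x4 X) * (F 0 (ix 5) = x5 X) * (F 0 (ix 6) = x6 X).
Proof. by rewrite /= !mxE !eq_ix //=; do ![split]; ring. Qed.

Lemma h3_coordP (x1 x2 x3 x4 x5 x6 : 'rV[R]_6 -> R) L :
    scalar x1 -> scalar x2 -> scalar x3 -> scalar x4 -> scalar x5 -> scalar x6 ->
    (forall X, x1 X = 0 -> x2 X = 0 -> x3 X = 0 -> x4 X = 0 -> x5 X = 0 ->
      x6 X = 0 -> X = 0) ->
    (forall X Y, let Z := br L X Y in [/\ [/\ x1 Z = 0, x2 Z = 0 & x3 Z = 0],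
      x4 Z = 0, x5 Z = 0 & x6 Z = - (wedge11 x1 x2 X Y + wedge11 x3 x4 X Y)]) ->
  lie_group_isomorphic L (h3 R).
Proof.
move=> l1 l2 l3 l4 l5 l6 inj hbr.
have lin : linear (h3_coord x1 x2 x3 x4 x5 x6).
  move=> c X Y; rewrite /h3_coord l1 l2 l3 l4 l5 l6.
  by apply/rowP => k; rewrite !mxE; ring.
have [F FE] := exists_linear lin.
apply: (@linear_lie_group_isomorphic _ _ F) => [X|X Y]; rewrite FE.
  move=> /rowP F0; have E := h3_coordE x1 x2 x3 x4 x5 x6 X.
  by apply: inj; rewrite -E F0 mxE.
have [[z1 z2 z3] z4 z5 z6] := hbr X Y.
rewrite /= /h3_br /wedge11 !h3_coordE /h3_coord z1 z2 z3 z4 z5 z6 /wedge11.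
by rewrite !scale0r !add0r.
Qed.

(** Let y = r_1 x_2 + r_2 x_3 + r_3 x_4.  The 2-form rho is
      x_1 /\ y - (1/r_1) (r_1 x_3 - r_2 x_2) /\ (r_1 x_4 - r_3 x_2),
    which gives the first four Darboux coordinates; the fifth vanishes on the
    derived algebra, and the sixth is normalized to be rho on it.  The hypothesis
    is invariant under cyclic permutations of x_2, x_3, x_4 and r_1, r_2, r_3, so
    any nonzero r_i can play the role of r_1. *)
Lemma darboux_h3 (x1 x2 x3 x4 x5 x6 : 'rV[R]_6 -> R) L (r1 r2 r3 c s : R) :
    scalar x1 -> scalar x2 -> scalar x3 -> scalar x4 -> scalar x5 -> scalar x6 ->
    (forall X, x1 X = 0 -> x2 X = 0 -> x3 X = 0 -> x4 X = 0 -> x5 X = 0 ->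
      x6 X = 0 -> X = 0) ->
    r1 != 0 -> c ^+ 2 + s ^+ 2 != 0 ->
    (forall X Y, let Z := br L X Y in
      let rho := r1 * (wedge11 x1 x2 X Y - wedge11 x3 x4 X Y)
        + r2 * (wedge11 x1 x3 X Y - wedge11 x4 x2 X Y)
        + r3 * (wedge11 x1 x4 X Y - wedge11 x2 x3 X Y) in
      [/\ [/\ x1 Z = 0, x2 Z = 0 & x3 Z = 0], x4 Z = 0,
        x5 Z = c * rho & x6 Z = s * rho]) ->
  lie_group_isomorphic L (h3 R).
Proof.
move=> l1 l2 l3 l4 l5 l6 inj r10 cs0 hbr.
apply: (@h3_coordP (fun X => - x1 X)
  (fun X => r1 * x2 X + r2 * x3 X + r3 * x4 X)
  (fun X => (r1 * x3 X - r2 * x2 X) / r1)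
  (fun X => r1 * x4 X - r3 * x2 X)
  (fun X => - s * x5 X + c * x6 X)
  (fun X => (c * x5 X + s * x6 X) / (c ^+ 2 + s ^+ 2))).
- by move=> k X Y; rewrite l1; ring.
- by move=> k X Y; rewrite l2 l3 l4; ring.
- by move=> k X Y; rewrite l2 l3; ring.
- by move=> k X Y; rewrite l2 l4; ring.
- by move=> k X Y; rewrite l5 l6; ring.
- by move=> k X Y; rewrite l5 l6; ring.
- move=> X /eqP; rewrite oppr_eq0 => /eqP z1 z2 z3 z4 z5 z6.
  have {}z3 : r1 * x3 X = r2 * x2 X.
    by move/eqP: z3; rewrite mulf_eq0 invr_eq0 (negPf r10) orbF subr_eq0 => /eqP.
  have {}z4 : r1 * x4 X = r3 * x2 X by apply/eqP; rewrite -subr_eq0 z4.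
  have {}z6 : c * x5 X + s * x6 X = 0.
    by move/eqP: z6; rewrite mulf_eq0 invr_eq0 (negPf cs0) orbF => /eqP.
  have r0 : r1 ^+ 2 + r2 ^+ 2 + r3 ^+ 2 != 0.
    by rewrite -addrA paddr_eq0 ?addr_ge0 ?sqr_ge0 // sqrf_eq0 (negPf r10).
  have x20 : x2 X = 0.
    apply: (mulfI r0); rewrite mulr0; transitivity (r1 * 0 : R); last by rewrite mulr0.
    rewrite -z2.
    transitivity (r1 ^+ 2 * x2 X + r2 * (r2 * x2 X) + r3 * (r3 * x2 X)); first by ring.
    by rewrite -z3 -z4; ring.
  apply: inj => //.
  + by apply: (mulfI r10); rewrite z3 x20 !mulr0.
  + by apply: (mulfI r10); rewrite z4 x20 !mulr0.
  + apply: (mulfI cs0); rewrite mulr0.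
    transitivity (c * (c * x5 X + s * x6 X) - s * (- s * x5 X + c * x6 X)).
      by ring.
    by rewrite z5 z6 !mulr0 subr0.
  + apply: (mulfI cs0); rewrite mulr0.
    transitivity (s * (c * x5 X + s * x6 X) + c * (- s * x5 X + c * x6 X)).
      by ring.
    by rewrite z5 z6 !mulr0 addr0.
- move=> X Y Z; have [[-> -> ->] -> -> ->] := hbr X Y.
  rewrite /wedge11; split; [split|..]; try by [ring | field].
  by field; rewrite r10 cs0.
Qed.

End LieGroups.

(** * Derived algebras of dimension one *)
Section Heisenberg.
Variables (R : realType) (L : nilpotent_lie_algebra R).
Variables (J : {linear 'rV[R]_6 -> 'rV[R]_6}) (g : 'rV[R]_6 -> 'rV[R]_6 -> R).
Hypothesis hermJ : hermitian_structure L J g.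
Variables (f : 'I_6 -> 'rV[R]_6) (p q : R * R * R).
Hypothesis sf : structure_frame L J g f p q.
Implicit Types (X Y : 'rV[R]_6).

Let gP : inner_product g. Proof. by case: hermJ. Qed.
Let fP : orthonormal g f. Proof. by case: sf => -[]. Qed.

Lemma parallel3_decomp : dot3 p p + dot3 q q != 0 -> parallel3 p q ->
  exists (r : R * R * R) (c s : R),
    [/\ dot3 r r != 0, c ^+ 2 + s ^+ 2 != 0,
      p = (c * r.1.1, c * r.1.2, c * r.2) & q = (s * r.1.1, s * r.1.2, s * r.2)].
Proof.
move=> pq0 [e12 e13 e23]; have [p0|p0] := eqVneq (dot3 p p) 0.
  exists q, 0, 1; rewrite p0 add0r in pq0.
  rewrite (dot3_eq0 p0) !mul0r !mul1r expr0n expr1n add0r oner_eq0.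
  by split=> //; case: (q) => [[]].
exists p, 1, (dot3 p q / dot3 p p).
split=> //.
- by rewrite expr1n paddr_eq0 ?ler01 ?sqr_ge0 // oner_eq0.
- by rewrite !mul1r; case: (p) => [[]].
have E u v : v * dot3 p p = dot3 p q * u -> v = dot3 p q / dot3 p p * u.
  by move=> E; apply: (mulIf p0); rewrite E; field.
move: p q e12 e13 e23 E {p0 pq0} => [[p1 p2] p3] [[q1 q2] q3] /= e12 e13 e23 E.
congr (_, _, _); apply: E; rewrite /dot3 /=.
- transitivity (p1 * p1 * q1 + p2 * (p2 * q1) + p3 * (p3 * q1)); first by ring.
  by rewrite -e12 -e13; ring.
- transitivity (p1 * (p1 * q2) + p2 * p2 * q2 + p3 * (p3 * q2)); first by ring.
  by rewrite e12 -e23; ring.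
- transitivity (p1 * (p1 * q3) + p2 * (p2 * q3) + p3 * p3 * q3); first by ring.
  by rewrite e13 e23; ring.
Qed.

Lemma parallel_isomorphic_h3 : dot3 p p + dot3 q q != 0 -> parallel3 p q ->
  lie_group_isomorphic L (h3 R).
Proof.
move=> pq0 /(parallel3_decomp pq0)[r [c [s [r0 cs0 pE qE]]]].
have lin k : scalar (g (f k)) by exact: ip_scalar.
have inj X : (forall k, g (f k) X = 0) -> X = 0.
  move=> X0; rewrite (frame_expand gP fP X) big1 // => k _.
  by rewrite X0 scale0r.
have brf k X Y : g (f (ix k)) (br L X Y) =
  asd g f p X Y * (ix k == ix 5)%:R + asd g f q X Y * (ix k == ix 6)%:R.
  by rewrite sf.2 (ipDr gP) !(ipZr gP) !fP.
have [r1|r1] := eqVneq r.1.1 0; last first.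
  apply: (@darboux_h3 _ (g (f (ix 1))) (g (f (ix 2))) (g (f (ix 3)))
    (g (f (ix 4))) (g (f (ix 5))) (g (f (ix 6))) _ r.1.1 r.1.2 r.2 c s) => //.
    by move=> *; apply: inj; apply: ord6P.
  move=> X Y; rewrite /= !brf !eq_ix //= !mulr0 !mulr1 !addr0 !add0r pE qE.
  by rewrite /asd /wedge11 /coframe /=; split=> //; ring.
have [r2|r2] := eqVneq r.1.2 0; last first.
  apply: (@darboux_h3 _ (g (f (ix 1))) (g (f (ix 3))) (g (f (ix 4)))
    (g (f (ix 2))) (g (f (ix 5))) (g (f (ix 6))) _ r.1.2 r.2 r.1.1 c s) => //.
    by move=> *; apply: inj; apply: ord6P.
  move=> X Y; rewrite /= !brf !eq_ix //= !mulr0 !mulr1 !addr0 !add0r pE qE.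
  by rewrite /asd /wedge11 /coframe /=; split=> //; ring.
have r3 : r.2 != 0.
  by apply: contraNneq r0 => r3; rewrite /dot3 r1 r2 r3 !mul0r !addr0.
apply: (@darboux_h3 _ (g (f (ix 1))) (g (f (ix 4))) (g (f (ix 2)))
  (g (f (ix 3))) (g (f (ix 5))) (g (f (ix 6))) _ r.2 r.1.1 r.1.2 c s) => //.
  by move=> *; apply: inj; apply: ord6P.
move=> X Y; rewrite /= !brf !eq_ix //= !mulr0 !mulr1 !addr0 !add0r pE qE.
by rewrite /asd /wedge11 /coframe /=; split=> //; ring.
Qed.

(** The derived algebra of h_3 is a line, so any two brackets in L are
    proportional. *)
Lemma isomorphic_h3_collinear : lie_group_isomorphic L (h3 R) ->
  forall X Y X' Y',
    asd g f p X Y * asd g f q X' Y' = asd g f q X Y * asd g f p X' Y'.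
Proof.
have st U V W : br L U (br L V W) = 0.
  by rewrite brC (br_2step sf) oppr0.
have st' U V W : br (h3 R) U (br (h3 R) V W) = 0 by exact: h3_2step.
move=> /(lie_group_isomorphic_linear st st')[F [Finj Fbr]] X Y X' Y'.
pose w (U V : 'rV[R]_6) : R :=
  - (wedge11 (fun Z : 'rV[R]_6 => Z 0 (ix 1)) (fun Z => Z 0 (ix 2)) U V
    + wedge11 (fun Z : 'rV[R]_6 => Z 0 (ix 3)) (fun Z => Z 0 (ix 4)) U V).
have FE U V : F (br L U V) = w (F U) (F V) *: delta_mx 0 (ix 6).
  by rewrite Fbr.
set k := w (F X) (F Y); set k' := w (F X') (F Y').
have col : k' *: br L X Y = k *: br L X' Y'.
  by apply: Finj; rewrite !linearZ /= !FE !scalerA mulrC.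
have zero U V : w (F U) (F V) = 0 -> br L U V = 0.
  by move=> w0; apply: Finj; rewrite FE w0 scale0r linear0.
have ab U V := br_frame hermJ sf U V.
have [k'0|k'0] := eqVneq k' 0.
  rewrite -(ab X' Y').1 -(ab X' Y').2 (zero X' Y' k'0) !(ip0l gP).
  by rewrite !mulr0.
apply: (mulfI k'0); rewrite !mulrA.
rewrite -(ab X Y).1 -(ab X Y).2 -!(ipZl gP) col !(ipZl gP) (ab X' Y').1 (ab X' Y').2.
by ring.
Qed.

End Heisenberg.

Theorem corollary5p6 (R : realType) (M : nilmanifold R)
    (J : {linear 'rV[R]_6 -> 'rV[R]_6}) (g : 'rV[R]_6 -> 'rV[R]_6 -> R)
    (e : 'I_6 -> 'rV[R]_6)
    (nonabM : ~ abelian_lie_algebra M)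
    (hermJ : hermitian_structure M J g)
    (balJ : balanced M J g)
    (adapted : adapted_frame J g e)
    (abJ : abelian_complex_structure M J) :
  (exists A : {linear 'rV[R]_6 -> 'M[R]_6}, strominger_solution M J g e A) /\
  (forall A : {linear 'rV[R]_6 -> 'M[R]_6}, strominger_solution M J g e A ->
     (heterotic_solution M J g e A <-> quotient_of_HxR M)).
Proof.
have gP : inner_product g by case: hermJ.
have eP : orthonormal g e by case: adapted.
have [f [p [q sf]]] := exists_structure_frame hermJ abJ eP balJ.
have [X0 [Y0 br0]] : exists X Y, br M X Y != 0.
  apply: contrapT => nobr; apply: nonabM => X Y; apply/eqP/negPn/negP => brXY.
  by apply: nobr; exists X, Y.
split.
  have [A [instA nflat anomaly]] := exists_anomaly_free hermJ abJ adapted sf br0.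
  exists A; split=> // r B.
  exact: holonomy_su3 gP adapted (bismut_su3_connection hermJ abJ adapted sf).
move=> A solA; split=> [[_ instB]|iso].
  apply: (parallel_isomorphic_h3 hermJ sf).
    by rewrite gt_eqF //; exact: (dot3_lin3_gt0 hermJ sf br0).1.
  apply: (commutator_parallel hermJ adapted sf).
  exact: (instanton_commutator hermJ abJ adapted sf).1.
split=> //; apply: (instanton_commutator hermJ abJ adapted sf).2.
apply: collinear_commutator.
exact: (isomorphic_h3_collinear hermJ sf iso).
Qed.
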